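(* Let $\alpha,\beta>\frac12$. For every $N\ge1$ let $-1=x_0<x_1<\dots<x_N=1$ be a set of nodes (depending on $N$), let $h_i=x_i-x_{i-1}$, $D_h=\operatorname{diag}(h_1,\dots,h_N)$, and let $H_N\in\mathbb{R}^{N\times N}$ be the associated weighted Jacobi histopolation matrix with respect to the basis $P^{(\alpha+1,\beta+1)}_{j-1}$, $j=1,\dots,N$ (see context). Then, for any fixed $\gamma<\frac12$, $$\left\{N^\gamma D_h^{1/2}H_N\right\}_N\sim_{\mathrm{GLT}}0 .$$
   Context: For $\alpha,\beta>-1$, $\omega_{\alpha,\beta}(t)=(1-t)^\alpha(1+t)^\beta$ on $[-1,1]$, and $P_j^{(\alpha,\beta)}$ is the Jacobi polynomial of degree $j$, orthogonal on $[-1,1]$ with respect to $\omega_{\alpha,\beta}$, with the standard normalization $P_j^{(\alpha,\beta)}(1)=\frac{\Gamma(j+\alpha+1)}{\Gamma(j+1)\Gamma(\alpha+1)}$. With $s_i=[x_{i-1},x_i]$, $$[H_N]_{i,j}=\frac1{h_i}\int_{s_i}P^{(\alpha+1,\beta+1)}_{j-1}(t)\,\omega_{\alpha,\beta}(t)\,dt,\quad i,j=1,\dots,N.$$ For a sequence of matrices $Z_N\in\mathbb{C}^{N\times N}$, $\{Z_N\}_N\sim_{\mathrm{GLT}}0$ (GLT sequence with symbol $0$) is equivalent to, and may be taken as defined by, $\{Z_N\}_N$ being zero-distributed ($\{Z_N\}_N\sim_\sigma0$): for every $F\in C_c(\mathbb{R})$, $\lim_{N\to\infty}\frac1N\sum_{i=1}^NF(\sigma_i(Z_N))=F(0)$,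 where $\sigma_i$ are the singular values; equivalently, for every $\varepsilon>0$, $\lim_{N\to\infty}\frac1N\#\{i:\sigma_i(Z_N)>\varepsilon\}=0$. *)

(* Defs.v *)
From mathcomp Require Export all_boot all_order all_algebra.
From mathcomp Require Export all_classical all_reals all_analysis.
From mathcomp Require Export complex.

Set Implicit Arguments.
Unset Strict Implicit.
Unset Printing Implicit Defensive.

Export Order.TTheory GRing.Theory Num.Theory.
Export numFieldNormedType.Exports.

Local Open Scope classical_set_scope.
Local Open Scope ring_scope.

Section Jacobi.
Context {R : realType}.
Local Notation mu := (@lebesgue_measure R).

(* Euler's integral; only meaningful for 0 < z. *)
Definition euler_Gamma (z : R) : R :=
  \int[mu]_(t in `]0, +oo[) (t `^ (z - 1) * expR (- t)).

Definition jacobi_weight (a b t : R) : R := (1 - t) `^ a * (1 + t) `^ b.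

(* For a, b > -1 these conditions determine P uniquely; P j is then the
   classical Jacobi polynomial of degree j with parameters (a, b). *)
Definition is_jacobi_family (a b : R) (P : nat -> {poly R}) : Prop :=
  [/\ forall j, size (P j) = j.+1,
      forall j k, j != k ->
        \int[mu]_(t in `[-1, 1]) ((P j).[t] * (P k).[t] * jacobi_weight a b t)
        = 0 &
      forall j, (P j).[1] = euler_Gamma (j%:R + a + 1)
                            / (euler_Gamma (j%:R + 1) * euler_Gamma (a + 1))].

End Jacobi.

Section Histopolation.
Context {R : realType}.
Local Notation mu := (@lebesgue_measure R).

(* Only the values x 0, ..., x N are constrained (and used). *)
Definition is_nodes (N : nat) (x : nat -> R) : Prop :=
  [/\ x 0%N = -1, x N = 1 & forall i, (i < N)%N -> x i < x i.+1].

(* Indices start at 0: for i : 'I_N this is the length of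
   the (i+1)-st segment [x i, x i.+1]. *)
Definition seg_len (x : nat -> R) (i : nat) : R := x i.+1 - x i.

Definition sqrt_len_mx (N : nat) (x : nat -> R) : 'M[R]_N :=
  diag_mx (\row_(i < N) Num.sqrt (seg_len x i)).

(* (a, b) are the parameters of the weight, P is the polynomial basis. *)
Definition histopolation_mx (a b : R) (P : nat -> {poly R}) (N : nat)
    (x : nat -> R) : 'M[R]_N :=
  \matrix_(i < N, j < N)
    ((seg_len x i)^-1 *
     \int[mu]_(t in `[x i, x i.+1]) ((P j).[t] * jacobi_weight a b t)).

End Histopolation.

Section ZeroDistribution.
Context {R : realType}.
Local Open Scope sesquilinear_scope.

(* Square roots of the eigenvalues, counted with multiplicity, of the
   Hermitian matrix Z^* Z; they are not sorted. *)
Definition singular_value (n : nat) (Z : 'M[R[i]]_n) (i : 'I_n) : R :=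
  Num.sqrt (complex.Re (spectral_diag (Z^t* *m Z) 0 i)).

(* A GLT sequence with symbol 0 is by definition a zero-distributed one:
   test functions are complex-valued, and R[i]^o is the copy of R[i] that
   carries the topology of the modulus. *)
Definition GLT_zero (Z : forall N : nat, 'M[R[i]]_N) : Prop :=
  forall F : R -> R[i]^o,
    continuous F -> compact (closure [set t | F t != 0]) ->
    (N%:R^-1 * \sum_(i < N) F (singular_value (Z N) i)) @[N --> \oo] --> F 0.

End ZeroDistribution.

(* Main.v *)
Require Import Defs.
From mathcomp Require Import ring lra zify measurable_realfun.

Set Implicit Arguments.
Unset Strict Implicit.
Unset Printing Implicit Defensive.

Local Open Scope classical_set_scope.
Local Open Scope ring_scope.

(** Write A = a + 1, B = b + 1 and w_(c,d)(t) = (1-t)^c (1+t)^d.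

    A sequence of matrices is zero-distributed as soon as the squared Frobenius
    norm divided by the size tends to 0: the squared singular values sum up to
    the squared Frobenius norm ([sum_singular_value_sqr]), and a bounded test
    function differs from its value at 0 by at most e + K t^2
    ([frobenius_GLT_zero]).

    The factor D_h^(1/2) has exactly the size for which the Frobenius norm can
    be bounded independently of the nodes.  The squared (i, j) entry of D_h^(1/2) H_N is
    1/h_i times the square of the integral of P_j w_(a,b) over s_i, hence at
    most the integral of P_j^2 w_(2a,2b) over s_i by Cauchy-Schwarz, and the
    segments add up to [-1, 1] ([histopolation_frobenius]).  Everything thus
    reduces to the bound
      int P_j^2 w_(2a,2b) <= C / (j + 1)      ([jacobi_family_decay]),
    because then the squared Frobenius norm of the N-th matrix, divided by N, is
    at most C N^(2 gamma - 1) (1 + ln N), which tends to 0 for gamma < 1/2.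

    The bound is proved in two steps.  First, the squared norms
    h_j = int P_j^2 w_(A,B) are O(1/j).  The normalization at 1 fixes the ratio
    P_j(1) / P_(j-1)(1) = (j + A) / j through the functional equation of Gamma;
    together with the relation that writes (1 - t^2) P_j' in terms of P_j and
    P_(j-1) ([structure_relation]) it determines h_j / h_(j-1) exactly
    ([norm_ratio]), and the resulting product is O(1/j) ([norm_ratio_decay]).

    Second, when a < 1 or b < 1 the weight w_(2a,2b) exceeds w_(A,B) near the
    ends, but it is at most a constant times w_(A-s,B-s) with s < 1/2: this is
    where a, b > 1/2 enters.  A virial argument compares the two: integrating
    the derivative of a suitable expression, quadratic in P_j and P_j', against
    the weight and eliminating P_j'' by the Jacobi differential equation leaves
      l (2 - 4 s) int P_j^2 w_(A-s,B-s)
        = l (4 - 4 s) int P_j^2 w_(A-s+1,B-s+1) + lower order terms,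
    where l is the eigenvalue of P_j ([virial_pointwise]).  For s < 1/2 the
    coefficient on the left is positive, so for large l the left integral is at
    most a constant times h_j ([virial_bound]).

    The differential equation and the structure relation are themselves derived
    from orthogonality by integration by parts ([jint_pearson]). *)

(** * Jacobi weights and integration by parts *)

Section Weight.
Context {R : realType}.
Implicit Types (a b t : R).

(** For negative bases the real power function is constantly 1, hence jumps
    at 0.  Truncating the base gives a function that is continuous everywhere,
    so that no continuity statement below needs to be relative to [-1, 1]. *)
Definition pos_powR a t : R := Num.max 0 t `^ a.

Lemma pos_powRE a t : 0 <= t -> pos_powR a t = t `^ a.
Proof. by move=> t0; rewrite /pos_powR max_r. Qed.

Lemma pos_powR_ge0 a t : 0 <= pos_powR a t.
Proof. exact: powR_ge0. Qed.

Lemma pos_powR_continuous a : 0 < a -> continuous (pos_powR a).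
Proof.
move=> a0 t; have [t0|t0|t0] := ltgtP t 0.
- have p0 : pos_powR a t = 0 by rewrite /pos_powR max_l ?ltW// powR0 ?gt_eqF.
  rewrite /continuous_at p0.
  have c0 : (fun _ : R => 0 : R) @ t --> (0 : R) by exact: cvg_cst.
  apply: cvg_trans c0.
  apply: near_eq_cvg; near=> y.
  rewrite /pos_powR max_l ?powR0 ?gt_eqF//.
  by apply: ltW; near: y; exact: lt_nbhsl.
- rewrite /continuous_at pos_powRE ?ltW//.
  have : {for t, continuous (fun y : R => y `^ a)}.
    apply: differentiable_continuous; apply/derivable1_diffP.
    by apply: derivable_powR; rewrite in_itv/= t0.
  apply: cvg_trans; apply: near_eq_cvg; near=> y.
  rewrite pos_powRE//; apply: ltW; near: y; exact: lt_nbhsr.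
- rewrite t0; apply/cvgrPdist_le => e e0; rewrite /pos_powR maxxx powR0 ?gt_eqF//.
  near=> y; rewrite sub0r normrN ger0_norm ?powR_ge0//.
  have -> : e = (e `^ a^-1) `^ a.
    by rewrite -powRrM mulVf ?gt_eqF// powRr1// ltW.
  apply: ge0_ler_powR; rewrite ?nnegrE ?powR_ge0 ?(ltW a0) ?le_max ?lexx//.
  rewrite ge_max powR_ge0/=; apply: ltW; near: y.
  by apply: lt_nbhsl; rewrite powR_gt0.
Unshelve. all: by end_near. Qed.

Lemma pos_powR_derive a t : 0 < t ->
  is_derive t 1 (pos_powR a) (a * pos_powR (a - 1) t).
Proof.
move=> t0; rewrite (pos_powRE (a - 1)) ?ltW//.
have /@is_derive1_powR - /(_ a) := t0; apply: near_eq_is_derive => //.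
near=> y; rewrite pos_powRE//; apply: ltW; near: y; exact: lt_nbhsr.
Unshelve. all: by end_near. Qed.

Definition weight a b t : R := pos_powR a (1 - t) * pos_powR b (1 + t).

Lemma weightE a b t : -1 <= t <= 1 -> weight a b t = jacobi_weight a b t.
Proof.
by move=> /andP[t0 t1]; rewrite /weight !pos_powRE//; [lra|lra].
Qed.

Lemma weight_ge0 a b t : 0 <= weight a b t.
Proof. by rewrite mulr_ge0 ?pos_powR_ge0. Qed.

Lemma weight_continuous a b : 0 < a -> 0 < b -> continuous (weight a b).
Proof.
move=> a0 b0 t; apply: cvgM.
- apply: (@continuous_comp _ _ _ (fun t => 1 - t) (pos_powR a)).
    by apply: cvgB; [exact: cvg_cst|exact: cvg_id].
  exact: pos_powR_continuous.
- apply: (@continuous_comp _ _ _ (fun t => 1 + t) (pos_powR b)).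
    by apply: cvgD; [exact: cvg_cst|exact: cvg_id].
  exact: pos_powR_continuous.
Qed.

Lemma weight_boundary a b : 0 < a -> 0 < b ->
  weight a b 1 = 0 /\ weight a b (-1) = 0.
Proof.
move=> a0 b0; rewrite /weight /pos_powR !subrr maxxx !powR0 ?gt_eqF//.
by rewrite mul0r mulr0.
Qed.

Lemma weight_derive a b t : -1 < t < 1 ->
  is_derive t 1 (weight (a + 1) (b + 1))
    ((b + 1) * (1 - t) * weight a b t - (a + 1) * (1 + t) * weight a b t).
Proof.
move=> /andP[t0 t1].
have h0 : 0 < 1 - t by lra.
have h1 : 0 < 1 + t by lra.
have d1 : is_derive t 1 (pos_powR (a + 1) \o (fun t => 1 - t))
   ((a + 1) * pos_powR a (1 - t) * (-1)).
  have := pos_powR_derive (a + 1) h0; rewrite addrK => d.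
  have d' : is_derive t 1 (fun t : R => 1 - t) (-1).
    by apply: is_derive_eq; rewrite add0r mul1r.
  by apply: (@is_derive1_comp _ (pos_powR (a + 1)) (fun t => 1 - t)).
have d2 : is_derive t 1 (pos_powR (b + 1) \o (fun t => 1 + t))
   ((b + 1) * pos_powR b (1 + t) * 1).
  have := pos_powR_derive (b + 1) h1; rewrite addrK => d.
  have d' : is_derive t 1 (fun t : R => 1 + t) 1.
    by apply: is_derive_eq; rewrite ?(add0r, mul1r).
  by apply: (@is_derive1_comp _ (pos_powR (b + 1)) (fun t => 1 + t)).
have := is_deriveM d1 d2.
move=> dX; apply: (is_derive_eq dX).
rewrite /weight /GRing.scale/= !pos_powRE ?ltW//.
have -> : (1 - t) `^ (a + 1) = (1 - t) * (1 - t) `^ a.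
  by rewrite powRD ?powRr1 ?ltW 1?mulrC//; apply/implyP => _; rewrite gt_eqF.
have -> : (1 + t) `^ (b + 1) = (1 + t) * (1 + t) `^ b.
  by rewrite powRD ?powRr1 ?ltW 1?mulrC//; apply/implyP => _; rewrite gt_eqF.
ring.
Qed.

Lemma weight_shift a b t : 0 < a -> 0 < b -> -1 <= t <= 1 ->
  weight (a + 1) (b + 1) t = (1 - t ^+ 2) * weight a b t.
Proof.
move=> a0 b0 /andP[t0 t1].
have h0 : 0 <= 1 - t by lra.
have h1 : 0 <= 1 + t by lra.
rewrite /weight !pos_powRE//.
have e c u : 0 <= u -> 0 < c -> u `^ (c + 1) = u * u `^ c.
  move=> u0 c0; rewrite powRD ?powRr1 1?mulrC//.
  by apply/implyP => /eqP; lra.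
by rewrite !e//; ring.
Qed.

End Weight.


Section SegmentIntegral.
Context {R : realType}.
Local Notation mu := (@lebesgue_measure R).
Implicit Types (u v : R) (f g : R -> R).

Lemma continuous_integrable f u v : continuous f ->
  mu.-integrable `[u, v] (EFin \o f).
Proof.
move=> cf; apply: continuous_compact_integrable; first exact: segment_compact.
exact: continuous_subspaceT.
Qed.

Lemma seg_RintegralD f g u v : continuous f -> continuous g ->
  \int[mu]_(t in `[u, v]) (f t + g t) =
  \int[mu]_(t in `[u, v]) f t + \int[mu]_(t in `[u, v]) g t.
Proof. by move=> cf cg; rewrite RintegralD//; exact: continuous_integrable. Qed.

Lemma seg_RintegralZ f c u v : continuous f ->
  \int[mu]_(t in `[u, v]) (c * f t) = c * \int[mu]_(t in `[u, v]) f t.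
Proof. by move=> cf; rewrite RintegralZl//; exact: continuous_integrable. Qed.

Lemma le_seg_Rintegral f g u v : continuous f -> continuous g ->
  (forall t, u <= t <= v -> f t <= g t) ->
  \int[mu]_(t in `[u, v]) f t <= \int[mu]_(t in `[u, v]) g t.
Proof.
move=> cf cg fg; apply: le_Rintegral => //; do ?exact: continuous_integrable.
Qed.

Lemma seg_Rintegral_cst u v c : u <= v ->
  \int[mu]_(t in `[u, v]) c = c * (v - u).
Proof.
move=> uv; rewrite Rintegral_cst//= lebesgue_measure_itv/= lte_fin.
case: ltP => [//|vu] /=; have -> : u = v by lra.
by rewrite subrr.
Qed.

Lemma seg_Rintegral_cat f u v w : continuous f -> u <= v -> v <= w ->
  \int[mu]_(t in `[u, w]) f t =
  \int[mu]_(t in `[u, v]) f t + \int[mu]_(t in `[v, w]) f t.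
Proof.
move=> cf uv vw.
have h : mu.-integrable [set` Interval (BLeft u) (BRight w)] (EFin \o f).
  exact: continuous_integrable.
have := @Rintegral_itvB R f (BLeft u) (BRight w) v h.
rewrite !bnd_simp => /(_ uv vw) e.
rewrite -(@Rintegral_itv_obnd_cbnd R v (BRight w)).
  by rewrite -e addrC subrK.
apply: (@integrableS _ _ _ mu `[u, w]) => //.
by move=> t /=; rewrite !in_itv/= => /andP[/ltW vt ->]; rewrite (le_trans uv vt).
Qed.

Lemma seg_Rintegral_gt0 f u v t0 : continuous f ->
  (forall t, u <= t <= v -> 0 <= f t) -> u < t0 < v -> 0 < f t0 ->
  0 < \int[mu]_(t in `[u, v]) f t.
Proof.
move=> cf f0 /andP[ut tv] ft0.
have /cvgrPdist_lt/(_ _ (divr_gt0 ft0 (ltr0n _ 2)))[e /= e0 he] := cf t0.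
pose d := Num.min (e / 2) (Num.min (t0 - u) (v - t0)).
have d0 : 0 < d by rewrite !lt_min divr_gt0// !subr_gt0 ut.
have de : d < e by rewrite gt_min; apply/orP; left; lra.
have dd : (d <= t0 - u) && (d <= v - t0).
  by rewrite -le_min /d ge_min lexx orbT.
move/andP: dd => [d1 d2].
rewrite (@seg_Rintegral_cat _ u (t0 - d))//; try lra.
rewrite (@seg_Rintegral_cat _ (t0 - d) (t0 + d))//; try lra.
have h1 : 0 <= \int[mu]_(t in `[u, t0 - d]) f t.
  by apply: Rintegral_ge0 => t /=; rewrite in_itv/= => /andP[? ?]; apply: f0; lra.
have h3 : 0 <= \int[mu]_(t in `[(t0 + d), v]) f t.
  by apply: Rintegral_ge0 => t /=; rewrite in_itv/= => /andP[? ?]; apply: f0; lra.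
have h2 : f t0 / 2 * (t0 + d - (t0 - d)) <= \int[mu]_(t in `[(t0 - d), (t0 + d)]) f t.
  rewrite -seg_Rintegral_cst; last lra.
  apply: le_seg_Rintegral => //; first by move=> ?; exact: cvg_cst.
  move=> t /andP[? ?]; have : ball t0 e t.
    by rewrite /ball/= ltr_norml; apply/andP; split; lra.
  move=> /he/=; rewrite ltr_norml => /andP[? ?]; lra.
have h : 0 < f t0 / 2 * (t0 + d - (t0 - d)) by rewrite mulr_gt0//; lra.
set I1 := Rintegral _ _ _ in h1 *; set I2 := Rintegral _ _ _ in h2 *.
set I3 := Rintegral _ _ _ in h3 *.
by rewrite ltr_wpDl// ltr_wpDr// (lt_le_trans h).
Qed.

Lemma cauchy_schwarz_seg f u v : continuous f -> u < v ->
  (\int[mu]_(t in `[u, v]) f t) ^+ 2 <=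
  (v - u) * \int[mu]_(t in `[u, v]) (f t ^+ 2).
Proof.
move=> cf uv; set I := Rintegral _ _ _; set J := Rintegral _ _ _.
have cf2 : continuous (fun t => f t ^+ 2).
  by move=> t; exact: (cvgM (cf t) (cf t)).
(* nonnegativity of the integral of the square of f minus its mean *)
pose m := I / (v - u).
have : 0 <= \int[mu]_(t in `[u, v]) (f t - m) ^+ 2.
  by apply: Rintegral_ge0 => t _; rewrite sqr_ge0.
have -> : \int[mu]_(t in `[u, v]) (f t - m) ^+ 2 =
          \int[mu]_(t in `[u, v]) (f t ^+ 2 + ((- 2 * m) * f t + m ^+ 2)).
  by apply: eq_Rintegral => t _; ring.
have cst_c (c : R) : continuous (fun _ : R => c) by move=> ?; exact: cvg_cst.
have cm : continuous (fun t => (- 2 * m) * f t).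
  by move=> t; exact: (cvgM (cst_c _ t) (cf t)).
rewrite seg_RintegralD//; last by move=> t; exact: (cvgD (cm t) (cst_c _ t)).
rewrite seg_RintegralD// seg_RintegralZ// (seg_Rintegral_cst _ (ltW uv)) -/I -/J.
have uv0 : 0 < v - u by lra.
have -> : J + (-2 * m * I + m ^+ 2 * (v - u)) = J - I ^+ 2 / (v - u).
  by rewrite /m; field; lra.
by rewrite subr_ge0 ler_pdivrMr// mulrC.
Qed.

End SegmentIntegral.


Section WeightedIntegral.
Context {R : realType}.
Local Notation mu := (@lebesgue_measure R).
Implicit Types (a b t : R) (p q : {poly R}).

Definition jint a b p : R :=
  \int[mu]_(t in `[-1, 1]) (p.[t] * weight a b t).

Lemma jintE a b p :
  jint a b p = \int[mu]_(t in `[-1, 1]) (p.[t] * jacobi_weight a b t).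
Proof.
by apply: eq_Rintegral => t; rewrite inE/= in_itv/= => /weightE ->.
Qed.

Section Positive.
Variables (a b : R).
Hypotheses (a0 : 0 < a) (b0 : 0 < b).

Lemma jint_continuous p : continuous (fun t => p.[t] * weight a b t).
Proof.
move=> t; apply: cvgM; first exact: continuous_horner.
exact: weight_continuous.
Qed.

Lemma jintD p q : jint a b (p + q) = jint a b p + jint a b q.
Proof.
rewrite -seg_RintegralD; try exact: jint_continuous.
by apply: eq_Rintegral => t _; rewrite hornerD mulrDl.
Qed.

Lemma jintZ c p : jint a b (c *: p) = c * jint a b p.
Proof.
rewrite /jint -(seg_RintegralZ c _ _ (@jint_continuous p)).
by apply: eq_Rintegral => t _; rewrite hornerZ -mulrA.
Qed.

Lemma jintN p : jint a b (- p) = - jint a b p.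
Proof. by rewrite -scaleN1r jintZ mulN1r. Qed.

Lemma jintB p q : jint a b (p - q) = jint a b p - jint a b q.
Proof. by rewrite jintD jintN. Qed.

Lemma jint_ge0 p : (forall t, -1 <= t <= 1 -> 0 <= p.[t]) -> 0 <= jint a b p.
Proof.
move=> p0; apply: Rintegral_ge0 => t /=; rewrite in_itv/= => /p0 ?.
by rewrite mulr_ge0// weight_ge0.
Qed.

Lemma jint_sqr_gt0 q : q != 0 -> 0 < jint a b (q ^+ 2).
Proof.
move=> q0.
(* more points of ]-1, 1[ than the degree allows roots *)
pose r (i : nat) : R := i.+2%:R^-1.
have r01 i : 0 < r i < 1.
  by rewrite invr_gt0 ltr0n/= invf_lt1 ?ltr0n// ltr1n.
have [t t01 qt] : exists2 t, -1 < t < 1 & q.[t] != 0.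
  apply: contrapT => H; move/negP: q0; apply.
  apply/eqP/(@roots_geq_poly_eq0 _ _ [seq r i | i <- iota 0 (size q)]).
  - apply/allP => _ /mapP[i _ ->]; apply: contrapT => /negP qi; apply: H.
    by exists (r i) => //; have := r01 i; lra.
  - rewrite map_inj_uniq ?iota_uniq// => i j /invr_inj/eqP.
    by rewrite eqr_nat => /eqP[].
  - by rewrite size_map size_iota.
apply: (@seg_Rintegral_gt0 _ _ _ _ t) => //.
- exact: jint_continuous.
- by move=> u _; rewrite horner_exp mulr_ge0 ?weight_ge0// sqr_ge0.
- rewrite horner_exp mulr_gt0// ?exprn_even_gt0//.
  move: t01 => /andP[t0 t1].
  by rewrite /weight !pos_powRE ?mulr_gt0// ?powR_gt0//; lra.
Qed.

Lemma jint_sqr_eq0 q : jint a b (q ^+ 2) = 0 -> q = 0.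
Proof.
move=> q0; apply/eqP; apply: contrapT => /negP /jint_sqr_gt0.
by rewrite q0 ltxx.
Qed.

Lemma jint_shift p :
  jint (a + 1) (b + 1) p = jint a b ((1 - 'X^2) * p).
Proof.
apply: eq_Rintegral => t; rewrite inE/= in_itv/= => t1.
by rewrite weight_shift//; move: (weight a b t) => w; rewrite !hornerE/=; ring.
Qed.

(** The integrand is the derivative of the product of [p] and the weight with
    both parameters raised by one, and this product vanishes at 1 and -1. *)
Lemma jint_pearson p :
  jint a b ((1 - 'X^2) * p^`() + ((b - a)%:P - (a + b + 2) *: 'X) * p) = 0.
Proof.
pose F t := p.[t] * weight (a + 1) (b + 1) t.
have a1 : 0 < a + 1 by rewrite ltr_wpDr.
have b1 : 0 < b + 1 by rewrite ltr_wpDr.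
have cF : continuous F.
  move=> t; apply: cvgM; first exact: continuous_horner.
  exact: weight_continuous.
have dF t : -1 < t < 1 -> is_derive t 1 F
    (((1 - 'X^2) * p^`() + ((b - a)%:P - (a + b + 2) *: 'X) * p).[t]
      * weight a b t).
  move=> t1; have := is_deriveM (is_derive_poly p t) (weight_derive a b t1).
  move=> d; apply: (is_derive_eq d).
  rewrite /GRing.scale/= weight_shift//; last by move/andP: t1 => [? ?]; lra.
  by move: (weight a b t) => w; rewrite !hornerE/=; ring.
have := @continuous_FTC2 R
  (fun t => ((1 - 'X^2) * p^`() + ((b - a)%:P - (a + b + 2) *: 'X) * p).[t]
      * weight a b t) F (-1) 1.
rewrite /jint /Rintegral => -> //.
- by rewrite /F; have [-> ->] := weight_boundary a1 b1; rewrite !mulr0/= subrr.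
- by apply: continuous_subspaceT; exact: jint_continuous.
- split.
  + by move=> t; rewrite in_itv/= => /dF d; exact: ex_derive.
  + by apply: cvg_at_right_filter; exact: cF.
  + by apply: cvg_at_left_filter; exact: cF.
- by move=> t; rewrite in_itv/= derive1E => /dF d; exact: derive_val.
Qed.

End Positive.

Lemma le_jint a b c d p q : 0 < a -> 0 < b -> 0 < c -> 0 < d ->
  (forall t, -1 <= t <= 1 -> p.[t] * weight a b t <= q.[t] * weight c d t) ->
  jint a b p <= jint c d q.
Proof.
by move=> a0 b0 c0 d0 pq; apply: le_seg_Rintegral => //; exact: jint_continuous.
Qed.

End WeightedIntegral.


(** * The differential equation of Jacobi polynomials *)

Section JacobiOperator.
Context {R : realType}.
Variables (A B : R).
Implicit Types (p q : {poly R}) (n m : nat).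

(** With [w] the weight with parameters [A] and [B], [((1 - t ^ 2) * w)' = tau * w],
    so that [w * jacobi_op p] is the derivative of [(1 - t ^ 2) * w * p']. *)
Definition tau : {poly R} := (B - A)%:P - (A + B + 2) *: 'X.

Definition jacobi_op p : {poly R} := (1 - 'X^2) * p^`()^`() + tau * p^`().

Lemma coef_deriv_natl q m : q^`()`_m = m.+1%:R * q`_m.+1.
Proof. by rewrite coef_deriv mulr_natl. Qed.

Lemma coef_jacobi_op p m : (jacobi_op p)`_m =
  (m.+2 * m.+1)%:R * p`_m.+2 + (B - A) * m.+1%:R * p`_m.+1
  - m%:R * (m%:R + A + B + 1) * p`_m.
Proof.
have e : jacobi_op p = p^`()^`() - p^`()^`() * 'X^2
    + ((B - A) *: p^`() - (A + B + 2) *: (p^`() * 'X)).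
  by rewrite /jacobi_op /tau -!mul_polyC; ring.
rewrite e !(coefD, coefN, coefZ) coefMXn coefMX !coef_deriv_natl.
case: m {e} => [|[|m]] /=.
- by rewrite !natrM; ring.
- by rewrite !natrM; ring.
- by rewrite subn2/= !natrM; ring.
Qed.

Lemma size_jacobi_op p n : (size p <= n)%N -> (size (jacobi_op p) <= n)%N.
Proof.
move=> pn; apply/leq_sizeP => j nj; rewrite coef_jacobi_op.
have pj : (size p <= j)%N by apply: leq_trans nj.
rewrite !(nth_default 0) ?(leqW pj) ?(leqW (leqW pj))//.
by rewrite !mulr0 subr0 addr0.
Qed.

Hypotheses (A0 : 0 < A) (B0 : 0 < B).
Local Notation L := (jint A B).

Lemma jacobi_op_sym p q : L (jacobi_op p * q) = L (p * jacobi_op q).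
Proof.
have H u v : L (jacobi_op u * v) = - L ((1 - 'X^2) * u^`() * v^`()).
  apply/eqP; rewrite -addr_eq0 -jintD//.
  rewrite -[X in _ == X](jint_pearson A0 B0 (u^`() * v)) derivM.
  by apply/eqP; congr jint; rewrite /jacobi_op /tau; ring.
by rewrite H [p * _]mulrC H; congr (- L _); ring.
Qed.

End JacobiOperator.

Section OrthogonalFamily.
Context {R : realType}.
Variables (A B : R) (P : nat -> {poly R}).
Hypotheses (A0 : 0 < A) (B0 : 0 < B).
Hypothesis sizeP : forall n, size (P n) = n.+1.
Hypothesis orthoP : forall n m, n != m -> jint A B (P n * P m) = 0.
Implicit Types (q : {poly R}) (n m : nat).
Local Notation L := (jint A B).

Definition jacobi_eig n : R := n%:R * (n%:R + A + B + 1).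

Lemma ortho_low n q : (size q <= n)%N -> L (P n * q) = 0.
Proof.
suff H k : (k <= n)%N -> forall r : {poly R}, (size r <= k)%N -> L (P n * r) = 0.
  exact: (H n).
elim: k => [_ r|k IH kn r rk].
  rewrite leqn0 size_poly_eq0 => /eqP ->.
  by rewrite mulr0 -(scale0r 0) jintZ// mul0r.
pose c := r`_k / (P k)`_k.
have Pk0 : (P k)`_k != 0.
  have := lead_coef_eq0 (P k); rewrite /lead_coef sizeP/= => ->.
  by rewrite -size_poly_eq0 sizeP.
have -> : r = (r - c *: P k) + c *: P k by rewrite subrK.
rewrite mulrDr jintD// IH ?(ltnW kn)//.
  by rewrite -scalerAr jintZ// orthoP ?mulr0 ?addr0// gtn_eqF.
apply/leq_sizeP => j; rewrite leq_eqVlt => /predU1P[<-|kj].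
  by rewrite coefB coefZ /c divfK// subrr.
rewrite coefB coefZ !nth_default ?mulr0 ?subr0//; first by rewrite sizeP.
by apply: leq_trans kj.
Qed.

(** [jacobi_op] is symmetric and does not raise degrees, so the defect of the
    eigenvalue equation has degree below [n] and is orthogonal to itself. *)
Lemma jacobi_ode n : jacobi_op A B (P n) = - jacobi_eig n *: P n.
Proof.
pose q := jacobi_op A B (P n) + jacobi_eig n *: P n.
have qn : (size q <= n)%N.
  apply/leq_sizeP => j nj; rewrite coefD coefZ coef_jacobi_op.
  rewrite [(P n)`_j.+1]nth_default ?sizeP// [(P n)`_j.+2]nth_default ?sizeP;
    last by lia.
  move: nj; rewrite leq_eqVlt => /predU1P[<-|nj].
    by rewrite /jacobi_eig; ring.
  by rewrite nth_default ?sizeP//; ring.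
have q0 : q = 0.
  apply: (@jint_sqr_eq0 _ A B) => //.
  rewrite expr2 {1}/q mulrDl jintD// jacobi_op_sym// -scalerAl jintZ//.
  by rewrite !ortho_low ?mulr0 ?addr0//; exact: size_jacobi_op.
by apply/eqP; rewrite scaleNr -addr_eq0 -/q q0.
Qed.

End OrthogonalFamily.


(** * Norms of Jacobi polynomials *)

Section NormRatioAlgebra.

(** Here [p], [k], [h] stand for the value at 1, the leading coefficient and
    the squared norm in degree [N], and the primed letters for those in degree
    [N - 1]: the hypotheses determine first [k / k'] and then [h / h']. *)
Lemma norm_ratio_algebra (F : realFieldType) (A B N k k' p p' h h' : F) :
  2 <= N -> 0 < A -> 0 < B -> p' != 0 -> k != 0 -> k' != 0 ->
  N * p = (N + A) * p' ->
  k * (4 * N * (N + A) * (N + B) * (N + A + B)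
    / ((2 * N + A + B) ^+ 2 * (2 * N + A + B - 1)) * (k / k') * h') =
    (2 * N + A + B + 1) * k' * h ->
  N * p = N * (A - B) / (2 * N + A + B) * p +
     4 * N * (N + A) * (N + B) * (N + A + B)
     / ((2 * N + A + B) ^+ 2 * (2 * N + A + B - 1)) * (k / k') * p' ->
  N * (N + A + B) * (2 * N + A + B + 1) * h =
  (N + A) * (N + B) * (2 * N + A + B - 1) * h'.
Proof.
move=> N2 A0 B0 p0 k0 k'0 rec SE ev.
have n1 : 2 * N + A + B != 0 by rewrite gt_eqF//; lra.
have n2 : 2 * N + A + B - 1 != 0 by rewrite gt_eqF//; lra.
have n3 : N != 0 by rewrite gt_eqF//; lra.
have n4 : N + A + B != 0 by rewrite gt_eqF//; lra.
have n5 : N + A != 0 by rewrite gt_eqF//; lra.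
have n6 : N + B != 0 by rewrite gt_eqF//; lra.
have n7 : 2 * N + A + B + 1 != 0 by rewrite gt_eqF//; lra.
have e : p = (N + A) / N * p' by rewrite mulrAC -rec mulrAC mulfV ?mul1r.
pose x := k / k'.
have xk : k = x * k' by rewrite divfK.
have hx : x = (2 * N + A + B) * (2 * N + A + B - 1) / (2 * N * (N + A + B)).
  pose G := 4 * N * (N + A) * (N + B) * (N + A + B)
    / ((2 * N + A + B) ^+ 2 * (2 * N + A + B - 1)) * p'.
  have G0 : G != 0.
    by rewrite !mulf_neq0 ?invr_neq0 ?mulf_neq0 ?expf_neq0 ?pnatr_eq0.
  apply: (mulIf G0).
  have -> : x * G = N * p - N * (A - B) / (2 * N + A + B) * p.
    by apply/eqP; rewrite eq_sym subr_eq {1}ev /G /x addrC; apply/eqP; ring.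
  by rewrite e /G; field; rewrite n1 n2 n3 n4.
have h'E : h = (2 * N + A + B + 1)^-1 *
  (4 * N * (N + A) * (N + B) * (N + A + B)
  / ((2 * N + A + B) ^+ 2 * (2 * N + A + B - 1)) * x ^+ 2 * h').
  apply: (mulfI k'0); apply: (mulfI n7).
  by rewrite [LHS]mulrA -[LHS]SE -/x xk; field; rewrite n1 n2 n7.
by rewrite h'E hx; field; rewrite n1 n2 n3 n4 n7.
Qed.

End NormRatioAlgebra.

Section NormRatio.
Context {R : realType}.
Variables (A B : R) (P : nat -> {poly R}).
Hypotheses (A0 : 0 < A) (B0 : 0 < B).
Hypothesis sizeP : forall n, size (P n) = n.+1.
Hypothesis orthoP : forall n m, n != m -> jint A B (P n * P m) = 0.
Variable m : nat.
Local Notation L := (jint A B).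
Local Notation n := m.+2.
Local Notation N := (m%:R + 2 : R).
Local Notation k := (P n)`_n.
Local Notation k' := (P m.+1)`_m.+1.

Let lead_neq0 j : (P j)`_j != 0.
Proof.
have := lead_coef_eq0 (P j); rewrite /lead_coef sizeP/= => ->.
by rewrite -size_poly_eq0 sizeP.
Qed.

Let m0 : 0 <= m%:R :> R. Proof. exact: ler0n. Qed.

Let N_bounds : (0 < 2 * N + A + B) && (0 < 2 * N + A + B - 1).
Proof. by move: m0 A0 B0; move: (m%:R : R) => M; lra. Qed.

Let natN : n%:R = N. Proof. by rewrite -[m.+2]addn2 natrD. Qed.
Let natN1 : m.+1%:R = m%:R + 1 :> R. Proof. by rewrite -natr1. Qed.

Lemma coef_second : (2 * N + A + B) * (P n)`_m.+1 = N * (A - B) * k.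
Proof.
have := congr1 (fun p : {poly R} => p`_m.+1) (jacobi_ode A0 B0 sizeP orthoP n).
rewrite coef_jacobi_op coefZ [(P n)`_m.+3]nth_default ?sizeP//.
rewrite /jacobi_eig natrM natN natN1.
move=> /eqP; rewrite -subr_eq0 => /eqP e; apply/eqP.
by rewrite -subr_eq0; apply/eqP; rewrite -[RHS]e; ring.
Qed.

Lemma coef_third : 2 * (2 * N + A + B - 1) * (P n)`_m =
  - ((N - 1) * (N * k + (B - A) * (P n)`_m.+1)).
Proof.
have := congr1 (fun p : {poly R} => p`_m) (jacobi_ode A0 B0 sizeP orthoP n).
rewrite coef_jacobi_op coefZ /jacobi_eig natrM natN natN1.
move=> /eqP; rewrite -subr_eq0 => /eqP e; apply/eqP.
by rewrite -subr_eq0; apply/eqP; rewrite -[RHS]e; ring.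
Qed.

Definition struct_diag : R := N * (A - B) / (2 * N + A + B).
Definition struct_sub : R :=
  4 * N * (N + A) * (N + B) * (N + A + B)
  / ((2 * N + A + B) ^+ 2 * (2 * N + A + B - 1)) * (k / k').

(** Both coefficients are chosen so that the two top coefficients of the
    difference of the two sides vanish; what remains has degree below [n - 1]
    and, by integration by parts, is orthogonal to itself. *)
Lemma structure_relation :
  (1 - 'X^2) * (P n)^`() =
  - n%:R *: ('X * P n) + struct_diag *: P n + struct_sub *: P m.+1.
Proof.
pose q := (1 - 'X^2) * (P n)^`() + n%:R *: ('X * P n)
          - struct_diag *: P n - struct_sub *: P m.+1.
have h1 : 2 * N + A + B != 0 by rewrite gt_eqF//; case/andP: N_bounds.
have h2 : 2 * N + A + B - 1 != 0 by rewrite gt_eqF//; case/andP: N_bounds.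
have e1 : (P n)`_m.+1 = N * (A - B) * k / (2 * N + A + B).
  by rewrite -coef_second mulrAC mulfV// mul1r.
have e2 : (P n)`_m = - ((N - 1) * (N * k + (B - A) * (P n)`_m.+1))
    / (2 * (2 * N + A + B - 1)).
  by rewrite -coef_third mulrAC mulfV ?mul1r// mulf_neq0// pnatr_eq0.
have kne := lead_neq0 n; have k'ne := lead_neq0 m.+1.
have qn : (size q <= m.+1)%N.
  apply/leq_sizeP => j nj.
  have -> : q = (1 - 'X^2) * (P n)^`() + n%:R *: (P n * 'X)
          - struct_diag *: P n - struct_sub *: P m.+1.
    by rewrite /q mulrC ['X * _]mulrC.
  rewrite !(coefD, coefN, coefZ) mulrBl mul1r (mulrC 'X^2) coefB coefMXn coefMX.
  rewrite !coef_deriv_natl.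
  move: nj; rewrite leq_eqVlt => /predU1P[<-|].
    (* coefficient of degree n - 1 *)
    have -> : (if (m.+1 < 2)%N then 0 else (m.+1 - 2).+1%:R * (P n)`_(m.+1 - 2).+1)
       = m%:R * (P n)`_m.
      by case: (m) => [|m'] /=; rewrite ?mul0r// subSS subn1.
    rewrite natN e2 e1 /struct_diag /struct_sub.
    by rewrite /=; field; rewrite k'ne h1 h2.
  rewrite leq_eqVlt => /predU1P[<-|].
    (* coefficient of degree n *)
    rewrite [(P n)`_m.+3]nth_default ?sizeP// [(P m.+1)`_m.+2]nth_default ?sizeP//.
    rewrite /= subSS subn1/= natN natN1 e1 /struct_diag.
    by field; rewrite h1.
  case: j => [|[|[|j]]]//; rewrite ltnS leq_eqVlt => /predU1P[jm|jm].
    (* coefficient of degree n + 1 *)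
    rewrite /= subSS subn1/= -jm [(P n)`_m.+4]nth_default ?sizeP//.
    rewrite [(P n)`_m.+3]nth_default ?sizeP// [(P m.+1)`_m.+3]nth_default ?sizeP//.
    by rewrite natN; ring.
  rewrite /= !nth_default ?sizeP// ?subSS ?subn1/=; try lia.
  by rewrite !mulr0 !subr0 addr0.
have q0 : q = 0.
  apply: (@jint_sqr_eq0 _ A B) => //.
  have := jint_pearson A0 B0 (P n * q).
  have -> : (1 - 'X^2) * (P n * q)^`() + ((B - A)%:P - (A + B + 2) *: 'X) * (P n * q)
     = q ^+ 2 + P n * ((1 - 'X^2) * q^`() + ((B - A)%:P - (A + B + 2) *: 'X) * q
           - n%:R *: ('X * q) + struct_diag *: q) + struct_sub *: (P m.+1 * q).
    by rewrite derivM /q -!mul_polyC; ring.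
  rewrite !jintD// jintZ// (ortho_low _ _ _ _ qn)// mulr0 addr0.
  rewrite ortho_low ?addr0//.
  have sq : (size (q^`()) <= m)%N.
    apply/leq_sizeP => j mj; rewrite coef_deriv nth_default ?mul0rn//.
    exact: leq_trans qn _.
  have s2 : (size ('X * q)%R <= m.+2)%N.
    by rewrite mulrC; apply: leq_trans (size_polyMleq _ _) _; rewrite size_polyX addn2.
  have s1 : (size (q : {poly R}) <= m.+2)%N by apply: leq_trans qn _.
  have s3 : (size ((1 - 'X^2) * q^`())%R <= m.+2)%N.
    apply: leq_trans (size_polyMleq _ _) _.
    have : (size (1 - 'X^2 : {poly R})%R <= 3)%N.
      apply: leq_trans (size_polyD _ _) _; rewrite size_polyN size_polyXn size_poly1.
      by rewrite geq_max.
    by move: sq; set u := size _; set v := size _; lia.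
  have -> : (1 - 'X^2) * q^`() + ((B - A)%:P - (A + B + 2) *: 'X) * q
           - n%:R *: ('X * q) + struct_diag *: q
   = (1 - 'X^2) * q^`() + (((B - A) + struct_diag) *: q
      - (A + B + 2 + n%:R) *: ('X * q)).
    by rewrite -!mul_polyC !polyCD; ring.
  apply: leq_trans (size_polyD _ _) _; rewrite geq_max s3/=.
  apply: leq_trans (size_polyD _ _) _; rewrite size_polyN geq_max.
  by rewrite (leq_trans (size_scale_leq _ _))// (leq_trans (size_scale_leq _ _)).
apply/eqP; rewrite -subr_eq0 -[X in _ == X]q0 /q -!mul_polyC.
by apply/eqP; rewrite polyCN; ring.
Qed.

Lemma ortho_lead (u : {poly R}) : (size u <= m.+3)%N ->
  k * L (P n * u) = u`_n * L (P n ^+ 2).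
Proof.
move=> su; have kne := lead_neq0 n.
pose c := u`_n / k.
have e : u = (u - c *: P n) + c *: P n by rewrite subrK.
rewrite {1}e mulrDr jintD// ortho_low//.
  by rewrite -scalerAr jintZ// -expr2 add0r mulrA [k * c]mulrC divfK.
apply/leq_sizeP => j; rewrite leq_eqVlt => /predU1P[<-|kj].
  by rewrite coefB coefZ /c divfK// subrr.
rewrite coefB coefZ !nth_default ?mulr0 ?subr0//; first by rewrite sizeP.
by apply: leq_trans kj.
Qed.

(** The structure relation tested against [P (n - 1)]. *)
Lemma struct_subE : k * (struct_sub * L (P m.+1 ^+ 2)) =
  (2 * N + A + B + 1) * k' * L (P n ^+ 2).
Proof.
pose u := n%:R *: (P m.+1 * 'X) + (A + B + 2) *: (P m.+1 * 'X) - (B - A) *: P m.+1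
          - ((P m.+1)^`() - (P m.+1)^`() * 'X^2).
have -> : struct_sub * L (P m.+1 ^+ 2) = L (P n * u).
  have H1 : L ((1 - 'X^2) * (P n)^`() * P m.+1) =
      L (- n%:R *: ('X * P n * P m.+1)) + struct_sub * L (P m.+1 ^+ 2).
    rewrite structure_relation -jintZ// -jintD//.
    rewrite -[RHS]addr0 -(mulr0 struct_diag).
    rewrite -[in RHS](@orthoP n m.+1) ?gtn_eqF// -[in RHS]jintZ// -[in RHS]jintD//.
    by congr jint; rewrite -!mul_polyC; ring.
  have H2 := jint_pearson A0 B0 (P n * P m.+1).
  have : struct_sub * L (P m.+1 ^+ 2) = L ((1 - 'X^2) * (P n)^`() * P m.+1)
     - L (- n%:R *: ('X * P n * P m.+1)) by rewrite H1 addrC addrA addNr add0r.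
  move=> ->; rewrite -[LHS]subr0 -[in LHS]H2 -!jintB//; congr jint.
  by rewrite /u derivM -!mul_polyC !polyCN !polyCD; ring.
have su : (size u <= m.+3)%N.
  apply/leq_sizeP => j nj.
  have z i : (m.+1 < i)%N -> (P m.+1)`_i = 0 by move=> ?; rewrite nth_default ?sizeP.
  rewrite /u !(coefD, coefN, coefZ) coefMXn !coefMX !coef_deriv_natl.
  case: j nj => [|[|j]]//= nj; rewrite subn2/=.
  by rewrite !z ?mulr0 ?subr0 ?addr0 ?oppr0//; lia.
rewrite ortho_lead//; congr (_ * _).
rewrite /u !(coefD, coefN, coefZ) coefMXn !coefMX !coef_deriv_natl /=.
rewrite subn2/= [(P m.+1)`_m.+2]nth_default ?sizeP// [(P m.+1)`_m.+3]nth_default ?sizeP//.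
by rewrite natN natN1; ring.
Qed.

(** Evaluating the structure relation at 1 gives [struct_sub] a second value;
    comparison with the first one yields the ratio of leading coefficients. *)
Lemma norm_ratio : (P m.+1).[1] != 0 -> N * (P n).[1] = (N + A) * (P m.+1).[1] ->
  N * (N + A + B) * (2 * N + A + B + 1) * L (P n ^+ 2) =
  (N + A) * (N + B) * (2 * N + A + B - 1) * L (P m.+1 ^+ 2).
Proof.
move=> p0 rec.
have ev := congr1 (horner^~ 1) structure_relation.
rewrite !hornerE/= natN in ev.
have N2 : 2 <= N by rewrite lerDr.
have H := norm_ratio_algebra N2 A0 B0 p0 (lead_neq0 n) (lead_neq0 m.+1) rec.
apply: H.
- exact: struct_subE.
- move: ev; rewrite expr1n subrr mul0r mulr1 -/struct_diag -/struct_sub => ev.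
  by apply/eqP; rewrite -subr_eq0 -oppr_eq0 [X in _ == X]ev; apply/eqP; ring.
Qed.

End NormRatio.


Section RatioDecay.
Context {R : realType}.
Implicit Types (A B : R) (h : nat -> R).

(** The recurrence multiplies [(2 n + A + B + 1) * h n] by
    [1 + A B / (n (n + A + B))] at each step, and the product of these factors
    converges because it is at most [exp (A B (1 - 1 / n))]. *)
Lemma norm_ratio_decay A B h : 0 < A -> 0 < B -> (forall n, 0 <= h n) ->
  (forall m : nat, let N := m%:R + 2 in
    N * (N + A + B) * (2 * N + A + B + 1) * h m.+2 =
    (N + A) * (N + B) * (2 * N + A + B - 1) * h m.+1) ->
  exists2 C, 0 <= C & forall n, h n <= C / n.+1%:R.
Proof.
move=> A0 B0 h0 rec.
pose K := (2 + A + B + 1) * h 1%N.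
have K0 : 0 <= K by rewrite mulr_ge0//; lra.
have AB0 : 0 < A * B by rewrite mulr_gt0.
have S1 (m : nat) : m.+1%:R = m%:R + 1 :> R by rewrite -natr1.
pose G (m : nat) := (2 * (m%:R + 1) + A + B + 1) * h m.+1.
have bound (m : nat) : G m <= K * expR (A * B * (1 - (m%:R + 1)^-1)).
  elim: m => [|m IH].
    by rewrite /G add0r invr1 subrr mulr0 expR0 mulr1 mulr1.
  have M0 : 0 <= m%:R :> R := ler0n _ m.
  have step : G m.+1 = (1 + A * B / ((m%:R + 2) * (m%:R + 2 + A + B))) * G m.
    have := rec m; rewrite /G (S1 m) /=.
    move: (h m.+2) (h m.+1) => h2 h1.
    move: (m%:R : R) M0 A0 B0 => M M0 A0 B0 e.
    have n1 : M + 2 != 0 by rewrite gt_eqF//; lra.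
    have n2 : M + 2 + A + B != 0 by rewrite gt_eqF//; lra.
    apply: (mulfI n1); apply: (mulfI n2).
    have -> : (M + 2 + A + B) * ((M + 2) * ((2 * (M + 1 + 1) + A + B + 1) * h2))
      = (M + 2) * (M + 2 + A + B) * (2 * (M + 2) + A + B + 1) * h2 by ring.
    by rewrite e; field; rewrite n1 n2.
  have le1 : 1 + A * B / ((m%:R + 2) * (m%:R + 2 + A + B))
     <= expR (A * B * ((m%:R + 1)^-1 - (m%:R + 2)^-1)).
    apply: le_trans (expR_ge1Dx _); rewrite lerD2l ler_pM2l//.
    move: (m%:R : R) M0 A0 B0 => M M0 A0 B0.
    have -> : (M + 1)^-1 - (M + 2)^-1 = ((M + 2) * (M + 1))^-1.
      by field; apply/andP; split; rewrite gt_eqF//; lra.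
    by rewrite lef_pV2 ?posrE ?mulr_gt0//; try lra; rewrite ler_pM2l; lra.
  rewrite step.
  apply: (@le_trans _ _ (expR (A * B * ((m%:R + 1)^-1 - (m%:R + 2)^-1))
     * (K * expR (A * B * (1 - (m%:R + 1)^-1))))).
    apply: ler_pM => //; last by rewrite mulr_ge0//; lra.
    by rewrite addr_ge0// divr_ge0 ?(ltW AB0)// mulr_ge0; lra.
  rewrite mulrCA -expRD (S1 m) le_eqVlt; apply/orP; left; apply/eqP.
  have -> : m%:R + 1 + 1 = m%:R + 2 :> R by ring.
  by congr (_ * expR _); ring.
pose C := K * expR (A * B) + h 0%N.
have KC : 0 <= K * expR (A * B) by rewrite mulr_ge0// expR_ge0.
exists C => [|[|n]]; first by rewrite addr_ge0.
  by rewrite divr1 lerDr.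
rewrite ler_pdivlMr ?ltr0n//.
apply: (@le_trans _ _ (G n)).
  rewrite mulrC ler_wpM2r// (S1 n.+1) (S1 n).
  by have : 0 <= n%:R :> R := ler0n _ n; lra.
apply: le_trans (bound n) _; rewrite -[leLHS]addr0 lerD// ler_wpM2l// ler_expR.
have n0 : 0 <= (n%:R + 1 : R)^-1 by rewrite invr_ge0 addr_ge0.
by rewrite ger_pMr// gerBl.
Qed.

End RatioDecay.


(** * A virial identity *)

Section VirialIdentity.
Context {R : realType}.
Variables (A B s : R).
Implicit Types (p : {poly R}) (l t : R).
Local Notation X := ('X : {poly R}).
Local Notation sg := (1 - 'X^2 : {poly R}).
Local Notation c := (A - s - 1).
Local Notation d := (B - s - 1).

(** The auxiliary polynomials of the virial identity.  [vir_rho] is determined by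
    the cancellation of the terms in [p' ^ 2], then [vir_r] by that of the terms
    in [p * p'], and [vir_Q] collects what [vir_r] contributes to [p ^ 2]. *)
Definition vir_rho : {poly R} :=
  (-1)%:P + (B - A) *: X - (A + B - 1 + 2 * s) *: X ^+ 2.

Definition vir_r : {poly R} :=
  vir_rho^`() * sg + (2 * s) *: (X * vir_rho).

Definition vir_Q : {poly R} :=
  sg * vir_r^`() + ((d - c)%:P - (c + d + 2) *: X) * vir_r.

Definition vir_T l p : {poly R} :=
  2 *: (X * sg ^+ 2 * p^`() ^+ 2) + (2 * l) *: (X * sg * p ^+ 2)
  + 2 *: (sg * vir_rho * p * p^`()) - vir_r * p ^+ 2.

Lemma deriv_sg : sg^`() = - 2 *: X.
Proof. by rewrite derivB derivC derivXn /= expr1 sub0r scaleNr scaler_nat. Qed.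

Lemma deriv_vir_rho :
  vir_rho^`() = (B - A)%:P - (2 * (A + B - 1 + 2 * s)) *: X.
Proof.
rewrite /vir_rho derivB derivD derivC add0r !derivZ derivX derivXn /= expr1.
by rewrite -!mul_polyC polyCM mulr_natl; ring.
Qed.

(** The left-hand side, times the weight with exponents [A - s - 1] and
    [B - s - 1], is an exact derivative.  Modulo the differential equation all
    terms containing a derivative of [p] cancel. *)
Lemma virial_pointwise l p : jacobi_op A B p = - l *: p ->
  sg * (vir_T l p)^`() + ((d - c)%:P - (c + d + 2) *: X) * vir_T l p =
  (2 * l * (4 - 4 * s)) *: (sg ^+ 2 * p ^+ 2)
  - (2 * l * (2 - 4 * s)) *: (sg * p ^+ 2) - vir_Q * p ^+ 2.
Proof.
move=> ode.
have E0 : jacobi_op A B p + l *: p = 0 by rewrite ode scaleNr addNr.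
rewrite -[RHS]addr0.
rewrite -[X in _ = _ + X](mulr0 (2 *: (sg * (2 *: ('X * sg * p^`()) + vir_rho * p)))).
rewrite -[in X in _ = _ + X]E0.
have Er : vir_r = vir_rho^`() * sg + (2 * s) *: (X * vir_rho) by [].
have Erho : vir_rho = (-1)%:P + (B - A) *: X - (A + B - 1 + 2 * s) *: X ^+ 2 by [].
have := deriv_vir_rho; move: Er Erho; rewrite /vir_T /vir_Q /jacobi_op /tau.
move: vir_r vir_rho => r rho Er Erho drho; rewrite drho in Er.
rewrite !(derivD, derivB, derivN, derivZ, derivM, deriv_sg, derivX, deriv_exp).
move: r^`() p^`()^`() => r' p2; rewrite drho Er Erho; move: p^`() => p1.
by rewrite -!mul_polyC; ring.
Qed.

(** Modulo [1 - X ^ 2] the polynomial [vir_Q] is affine, with the nonnegative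
    values 8 s (A^2 - s^2) at 1 and 8 s (B^2 - s^2) at -1. *)
Lemma vir_Q_lower : 0 <= s -> s <= A -> s <= B ->
  exists2 C, 0 <= C & forall t, -1 <= t <= 1 ->
    - C * (1 - t ^+ 2) <= vir_Q.[t].
Proof.
move=> s0 sA sB.
pose K := A + B - 1 + 2 * s.
pose r2 := (2 * s - 1) * (B - A); pose r3 := (2 - 2 * s) * K.
pose u : {poly R} := vir_r^`()
  - ((d - c)%:P - (c + d + 2) *: X) * (r2%:P + r3 *: X)
  - ((c + d + 2) * (2 * s * (A + B + 2 * s)))%:P.
pose C := \sum_(i < size u) `|u`_i|.
exists C => [|t t1]; first by apply: sumr_ge0.
have tn : `|t| <= 1 by rewrite ler_norml.
have sg0 : 0 <= 1 - t ^+ 2 by rewrite subr_ge0 -real_normK ?num_real// expr_le1.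
have uC : - C <= u.[t].
  have : `|u.[t]| <= C.
    rewrite horner_coef; apply: le_trans (ler_norm_sum _ _ _) _.
    apply: ler_sum => i _; rewrite normrM normrX ler_piMr//.
    by rewrite exprn_ile1.
  by rewrite ler_norml => /andP[].
have rE : vir_r.[t] = (B - A) * (2 * s) - (2 * s * (A + B + 2 * s)) * t
   - (1 - t ^+ 2) * (r2 + r3 * t).
  by rewrite /vir_r deriv_vir_rho /vir_rho /r2 /r3 /K !hornerE/=; ring.
have -> : vir_Q.[t] = (1 - t ^+ 2) * u.[t] +
   (4 * s * (1 + t) * (A ^+ 2 - s ^+ 2) + 4 * s * (1 - t) * (B ^+ 2 - s ^+ 2)).
  rewrite /vir_Q /u; move: rE.
  move: vir_r^`() vir_r => r' r; rewrite !hornerE/= => ->; ring.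
have h1 : 0 <= A ^+ 2 - s ^+ 2 by rewrite subr_ge0 ler_sqr ?nnegrE// (le_trans s0).
have h2 : 0 <= B ^+ 2 - s ^+ 2 by rewrite subr_ge0 ler_sqr ?nnegrE// (le_trans s0).
have h : 0 <= 4 * s * (1 + t) * (A ^+ 2 - s ^+ 2) + 4 * s * (1 - t) * (B ^+ 2 - s ^+ 2).
  by move/andP: t1 => [t1 t2]; rewrite addr_ge0// !mulr_ge0//; lra.
by rewrite ler_wpDr// mulrC ler_wpM2l.
Qed.

End VirialIdentity.

Section VirialBound.
Context {R : realType}.
Implicit Types (a b A B s t l : R) (p : {poly R}).

Lemma weight_mul_sg a b e t : 0 < a -> 0 < b -> 0 <= e -> -1 <= t <= 1 ->
  weight (a + e) (b + e) t <= weight a b t.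
Proof.
move=> a0 b0 e0 /andP[t0 t1].
have h0 : 0 <= 1 - t by lra.
have h1 : 0 <= 1 + t by lra.
rewrite /weight !pos_powRE// !powRD; try by apply/implyP => /eqP; lra.
rewrite mulrACA ler_piMr ?mulr_ge0 ?powR_ge0// -powRM//.
have e1 : 1 `^ e = 1 :> R by rewrite powR1.
rewrite -[leRHS]e1 ge0_ler_powR ?nnegrE ?mulr_ge0//.
by have := sqr_ge0 t; lra.
Qed.

(** Integrating the identity bounds the integral of [p ^ 2] against a weight
    lowered by [s < 1 / 2] by the one against the original weight, uniformly
    in the eigenvalue. *)
Lemma virial_bound A B s : 0 <= s -> s < 2^-1 -> s + 1 < A -> s + 1 < B ->
  exists l0 C, [/\ 0 < l0, 0 <= C & forall l p, l0 <= l ->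
    jacobi_op A B p = - l *: p ->
    jint (A - s) (B - s) (p ^+ 2) <= C * jint A B (p ^+ 2)].
Proof.
move=> s0 s2 sA sB.
have [C C0 QC] := @vir_Q_lower R A B s s0 (ltac:(lra)) (ltac:(lra)).
have c0 : 0 < A - s - 1 by lra.
have d0 : 0 < B - s - 1 by lra.
have A0 : 0 < A by lra.
have B0 : 0 < B by lra.
have k0 : 0 < 2 - 4 * s by lra.
exists (1 + C / (2 - 4 * s)), ((8 - 8 * s) / (2 - 4 * s)); split.
- by rewrite ltr_wpDr// divr_ge0// ltW.
- by rewrite divr_ge0 ?(ltW k0)//; lra.
move=> l p lC ode.
have := jint_pearson c0 d0 (vir_T A B s l p).
rewrite virial_pointwise// !jintB// !jintZ//.
set H := jint _ _ (_ ^+ 2 * _); set Q := jint _ _ (vir_Q _ _ _ * _).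
set Xs := jint _ _ (_ * _).
have -> : jint (A - s) (B - s) (p ^+ 2) = Xs.
  by rewrite /Xs -jint_shift// !subrK.
have Hh : H <= jint A B (p ^+ 2).
  apply: le_jint => // t t1.
  rewrite hornerM mulrAC mulrC ler_wpM2l//; first by rewrite horner_exp sqr_ge0.
  have -> : ((1 - 'X^2 : {poly R}) ^+ 2).[t] * weight (A - s - 1) (B - s - 1) t
      = weight (A + (1 - s)) (B + (1 - s)) t.
    have -> : A + (1 - s) = A - s - 1 + 1 + 1 by ring.
    have -> : B + (1 - s) = B - s - 1 + 1 + 1 by ring.
    rewrite !weight_shift//; try by clear -c0 d0; lra.
    by move: (weight _ _ _) => w; rewrite !hornerE/=; ring.
  by apply: weight_mul_sg => //; lra.
have QX : - C * Xs <= Q.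
  rewrite -jintZ//; apply: le_jint => // t t1.
  rewrite ler_wpM2r ?weight_ge0// hornerZ !(hornerM _ (p ^+ 2)) mulrA.
  rewrite ler_wpM2r//.
    by rewrite horner_exp sqr_ge0.
  by apply: le_trans (QC t t1); rewrite !hornerE.
have X0 : 0 <= Xs.
  apply: jint_ge0 => // t /andP[t0 t1]; rewrite hornerM mulr_ge0//.
    by rewrite !hornerE; nra.
  by rewrite horner_exp sqr_ge0.
move: H Q Xs (jint A B _) Hh QX X0 => H Q Xs h Hh QX X0 E.
have l_gt0 : 0 < l by apply: lt_le_trans lC; rewrite ltr_wpDr// divr_ge0// ltW.
have lk : C <= l * (2 - 4 * s).
  by rewrite -ler_pdivrMr//; apply: le_trans lC; rewrite lerDr.
have e1 : 2 * l * (4 - 4 * s) * H <= 2 * l * (4 - 4 * s) * h.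
  by rewrite ler_wpM2l// !mulr_ge0//; lra.
have e2 : C * Xs <= l * (2 - 4 * s) * Xs by rewrite ler_wpM2r.
rewrite mulrAC ler_pdivlMr// -(ler_pM2l l_gt0).
clear ode lC; lra.
Qed.

End VirialBound.


(** * The functional equation of the Gamma function *)

Section Gamma.
Context {R : realType}.
Local Notation mu := (@lebesgue_measure R).
Implicit Types (z t : R).

(** Euler's integrand, with the truncated power that makes it continuous. *)
Definition gamma_fun z t : R := pos_powR (z - 1) t * expR (- t).

Lemma gamma_fun_ge0 z t : 0 <= gamma_fun z t.
Proof. by rewrite mulr_ge0 ?pos_powR_ge0 ?expR_ge0. Qed.

Lemma exp_continuous (c : R) : continuous (fun t => expR (c * t)).
Proof.
move=> t; apply: (@continuous_comp _ _ _ (fun t => c * t) (@expR R)).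
  by apply: cvgM; [exact: cvg_cst|exact: cvg_id].
exact: continuous_expR.
Qed.

Lemma gamma_fun_continuous z : 1 < z -> continuous (gamma_fun z).
Proof.
move=> z1 t; apply: cvgM; first by apply: pos_powR_continuous; rewrite subr_gt0.
have := @exp_continuous (-1) t.
rewrite /continuous_at mulN1r; apply: cvg_trans.
by apply: near_eq_cvg; near=> y; rewrite mulN1r.
Unshelve. all: by end_near. Qed.

(** From [1 + u <= exp u] at [u = t / (2 (z - 1))], raised to the power
    [z - 1]. *)
Lemma gamma_fun_bound z : 1 < z -> exists2 K, 0 <= K &
  forall t, 0 <= t -> gamma_fun z t <= K * expR (- 2^-1 * t).
Proof.
move=> z1; have c0 : 0 < z - 1 by rewrite subr_gt0.
have d0 : 0 < 2 * (z - 1) by rewrite mulr_gt0.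
exists ((2 * (z - 1)) `^ (z - 1)); first exact: powR_ge0.
move=> t t0; rewrite /gamma_fun pos_powRE//.
have -> : expR (- t) = expR (- 2^-1 * t) * expR (- 2^-1 * t).
  by rewrite -expRD; congr expR; lra.
rewrite mulrA ler_wpM2r ?expR_ge0//.
have u0 : 0 <= t / (2 * (z - 1)) by rewrite divr_ge0// ltW.
have h : (t / (2 * (z - 1))) `^ (z - 1) <= expR (2^-1 * t).
  have -> : expR (2^-1 * t) = expR (t / (2 * (z - 1))) `^ (z - 1).
    by rewrite -expRM; congr expR; field; rewrite gt_eqF.
  apply: ge0_ler_powR; rewrite ?nnegrE ?expR_ge0 ?(ltW c0)//.
  by apply: le_trans (expR_ge1Dx _); rewrite lerDr.
have -> : t `^ (z - 1) = (2 * (z - 1)) `^ (z - 1) * (t / (2 * (z - 1))) `^ (z - 1).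
  rewrite -powRM//; last exact: ltW.
  by rewrite mulrC divfK// gt_eqF.
rewrite -mulrA ler_piMr ?powR_ge0// mulNr expRN.
by rewrite ler_pdivrMr ?expR_gt0// mul1r.
Qed.

Lemma half_line_FTC (f F : R -> R) (l : R) :
  (forall t, 0 <= t -> 0 <= f t) -> continuous f -> continuous F ->
  (forall t, 0 < t -> is_derive t 1 F (f t)) ->
  F t @[t --> +oo] --> l ->
  (\int[mu]_(t in `[0%R, +oo[) (f t)%:E = (l - F 0)%:E)%E.
Proof.
move=> f0 cf cF dF Fl; rewrite EFinB; apply: ge0_continuous_FTC2y => //.
- exact: continuous_subspaceT.
- by move=> t /dF d; exact: ex_derive.
- by apply: cvg_at_right_filter; exact: cF.
- by move=> t; rewrite in_itv/= andbT derive1E => /dF d; rewrite derive_val.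
Qed.

Lemma exp_half_cvg0 : expR (- 2^-1 * t) @[t --> +oo] --> (0 : R).
Proof.
apply/cvgrPdist_lt => e e0; near=> t.
rewrite sub0r normrN ger0_norm ?expR_ge0// mulNr expRN.
have t0 : 0 < t by near: t; exact: nbhs_pinfty_gt.
have te : 2 / e < t by near: t; apply: nbhs_pinfty_gt; rewrite num_real.
rewrite invf_plt ?posrE ?expR_gt0//.
apply: lt_le_trans (expR_ge1Dx _).
by rewrite ltr_wpDl// ltr_pdivlMl// mulrC.
Unshelve. all: by end_near. Qed.

Lemma exp_half_derive (c t : R) :
  is_derive t 1 (fun t => c * expR (- 2^-1 * t)) (c * (- 2^-1 * expR (- 2^-1 * t))).
Proof.
have d : is_derive t 1 (fun t : R => - 2^-1 * t) (- 2^-1).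
  by apply: is_derive_eq; rewrite /GRing.scale/= mulr1.
have e : is_derive t 1 (fun t : R => expR (- 2^-1 * t))
    (expR (- 2^-1 * t) * - 2^-1).
  exact: (@is_derive1_comp _ (@expR R) (fun t => - 2^-1 * t)).
have := is_deriveM (is_derive_cst c t 1) e => e'.
by apply: (is_derive_eq e'); rewrite /GRing.scale/=; ring.
Qed.

Lemma exp_half_integral :
  (\int[mu]_(t in `[0%R, +oo[) (expR (- 2^-1 * t))%:E = 2%:E)%E.
Proof.
pose F t : R := - 2 * expR (- 2^-1 * t).
have -> : 2%:E = (0 - F 0)%:E :> \bar R.
  by rewrite /F mulr0 expR0 mulr1 sub0r opprK.
apply: half_line_FTC.
- by move=> t _; exact: expR_ge0.
- exact: exp_continuous.
- by move=> t; apply: cvgM; [exact: cvg_cst|exact: exp_continuous].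
- move=> t _; apply: (is_derive_eq (exp_half_derive _ _)).
  by rewrite mulrA mulrNN mulfV ?mul1r.
- rewrite -[X in _ --> X](mulr0 (- 2)).
  by apply: cvgM; [exact: cvg_cst|exact: exp_half_cvg0].
Qed.

Lemma exp_half_integrable :
  mu.-integrable `[0, +oo[ (EFin \o (fun t => expR (- 2^-1 * t))).
Proof.
apply/integrableP; split.
  apply/measurable_EFinP; apply: measurable_funTS.
  by apply: continuous_measurable_fun; exact: exp_continuous.
under eq_integral do rewrite /= ger0_norm ?expR_ge0//.
by rewrite exp_half_integral ltry.
Qed.

Lemma gamma_integrable z : 1 < z ->
  mu.-integrable `[0, +oo[ (EFin \o gamma_fun z).
Proof.
move=> z1; have [K K0 HK] := gamma_fun_bound z1.
have ig : mu.-integrable `[0, +oo[ (fun t => (K%:E * (expR (- 2^-1 * t))%:E)%E).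
  by apply: integrableZl => //; exact: exp_half_integrable.
apply: le_integrable ig => //.
- apply/measurable_EFinP; apply: measurable_funTS.
  by apply: continuous_measurable_fun; exact: gamma_fun_continuous.
- move=> t /=; rewrite in_itv/= andbT => t0; rewrite lee_fin.
  rewrite ger0_norm ?gamma_fun_ge0// ger0_norm ?mulr_ge0 ?expR_ge0//.
  exact: HK.
Qed.

Lemma euler_GammaE z : 1 < z ->
  euler_Gamma z = \int[mu]_(t in `[0, +oo[) gamma_fun z t.
Proof.
move=> z1; rewrite -Rintegral_itv_obnd_cbnd.
  apply: eq_Rintegral => t; rewrite inE/= in_itv/= andbT => t0.
  by rewrite /gamma_fun pos_powRE// ltW.
apply: integrableS (gamma_integrable z1) => //.
by move=> t /=; rewrite !in_itv/= !andbT => /ltW.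
Qed.

Lemma euler_Gamma_gt0 z : 1 < z -> 0 < euler_Gamma z.
Proof.
move=> z1; rewrite euler_GammaE//.
have h : 0 < \int[mu]_(t in `[1, 3]) gamma_fun z t.
  apply: (@seg_Rintegral_gt0 _ _ _ _ 2).
  - exact: gamma_fun_continuous.
  - by move=> t _; exact: gamma_fun_ge0.
  - by rewrite ltr_nat ltr1n.
  - by rewrite mulr_gt0 ?expR_gt0// pos_powRE// powR_gt0.
apply: (lt_le_trans h).
have I := gamma_integrable z1.
have sub : ([set` `[1%R, 3%R]] : set R) `<=` [set` `[0%R, +oo[].
  by move=> t /=; rewrite !in_itv/= andbT => /andP[t1 _]; rewrite (le_trans _ t1).
rewrite /Rintegral fine_le//.
- by apply: integrable_fin_num => //; exact: integrableS I.
- exact: integrable_fin_num.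
- apply: ge0_subset_integral => //.
  + by apply/measurable_EFinP; apply: measurable_funTS;
      apply: continuous_measurable_fun; exact: gamma_fun_continuous.
  + by move=> t _; rewrite lee_fin gamma_fun_ge0.
Qed.

(** The integrand [gamma_fun (z + 1) - z * gamma_fun z] has the antiderivative
    [- gamma_fun (z + 1)], which vanishes at both ends.  Adding a multiple of
    [exp (- t / 2)] makes the integrand nonnegative, so that the fundamental
    theorem applies on the half-line. *)
Lemma euler_GammaS z : 1 < z -> euler_Gamma (z + 1) = z * euler_Gamma z.
Proof.
move=> z1; have z2 : 1 < z + 1 by rewrite ltr_wpDr.
have z0 : 0 < z by apply: lt_trans z1.
rewrite !euler_GammaE//.
have [K K0 HK] := gamma_fun_bound z1.
have [K' K'0 HK'] := gamma_fun_bound z2.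
pose e t : R := expR (- 2^-1 * t).
pose f t := gamma_fun (z + 1) t + ((- z) * gamma_fun z t + (z * K) * e t).
pose F t := - gamma_fun (z + 1) t + (- 2 * (z * K)) * e t.
have cg := gamma_fun_continuous z1; have cg' := gamma_fun_continuous z2.
have ce : continuous e by exact: exp_continuous.
have ig := gamma_integrable z1; have ig' := gamma_integrable z2.
have ie := exp_half_integrable.
have cf : continuous f.
  move=> t; apply: cvgD; first exact: cg'.
  apply: cvgD; apply: cvgM; try exact: cvg_cst.
    exact: cg.
  exact: ce.
have cF : continuous F.
  move=> t; apply: cvgD; first by apply: cvgN; exact: cg'.
  by apply: cvgM; [exact: cvg_cst|exact: ce].
have f0 t : 0 <= t -> 0 <= f t.
  move=> t0; rewrite /f addr_ge0 ?gamma_fun_ge0// addrC mulNr subr_ge0 -mulrA.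
  by rewrite ler_pM2l//; exact: HK.
have dF t : 0 < t -> is_derive t 1 F (f t).
  move=> t0; have d1 := pos_powR_derive (z + 1 - 1) t0.
  have d2 : is_derive t 1 (fun u : R => expR (- u)) (expR (- t) * -1).
    by apply: (@is_derive1_comp _ (@expR R) (fun u => - u)).
  have := is_deriveD (is_deriveN (is_deriveM d1 d2))
                     (exp_half_derive (- 2 * (z * K)) t).
  move=> d; apply: (is_derive_eq d).
  by rewrite /f /e /gamma_fun /GRing.scale/= addrK; field.
have Fl : F t @[t --> +oo] --> (0 : R).
  have g0 : gamma_fun (z + 1) t @[t --> +oo] --> (0 : R).
    apply: (@squeeze_cvgr _ _ _ _ (fun=> 0) (fun t => K' * e t)).
    - near=> t; rewrite gamma_fun_ge0/=; apply: HK'.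
      by near: t; exact: nbhs_pinfty_ge.
    - exact: cvg_cst.
    - rewrite -[X in _ --> X](mulr0 K').
      by apply: cvgM; [exact: cvg_cst|exact: exp_half_cvg0].
  rewrite -[X in _ --> X](addr0 0) -{1}oppr0 -[X in _ --> - 0 + X](mulr0 (- 2 * (z * K))).
  apply: cvgD; first exact: cvgN.
  by apply: cvgM; [exact: cvg_cst|exact: exp_half_cvg0].
have F0 : F 0 = - 2 * (z * K).
  by rewrite /F /e mulr0 expR0 mulr1 /gamma_fun addrK pos_powRE// powR0 ?gt_eqF// mul0r oppr0 add0r.
have H := half_line_FTC f0 cf cF dF Fl.
have : \int[mu]_(t in `[0, +oo[) f t = 2 * (z * K).
  by rewrite /Rintegral H F0 /= sub0r mulNr opprK.
have iz c (h : R -> R) : mu.-integrable `[0, +oo[ (EFin \o h) ->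
   mu.-integrable `[0, +oo[ (EFin \o (fun t => c * h t)).
  by move=> ih; exact: (integrableZl _ c ih).
have i2 : mu.-integrable `[0, +oo[ (EFin \o (fun t => - z * gamma_fun z t + z * K * e t)).
  have := integrableD _ (iz (- z) _ ig) (iz (z * K) _ ie).
  by apply; exact: measurable_itv.
rewrite (RintegralD _ ig' i2)// (RintegralD _ (iz _ _ ig) (iz _ _ ie))//.
rewrite !RintegralZl//.
have -> : \int[mu]_(t in `[0, +oo[) e t = 2.
  by rewrite /Rintegral exp_half_integral.
move: (Rintegral _ _ _) (Rintegral _ _ _) => I J E.
lra.
Unshelve. all: by end_near. Qed.

End Gamma.


(** * Decay of the weighted square norms *)

Section FamilyDecay.
Context {R : realType}.
Implicit Types (a b t : R) (P : nat -> {poly R}).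

Lemma jacobi_eval1_gt0 A B P m : 0 < A -> is_jacobi_family A B P ->
  0 < (P m.+1).[1].
Proof.
move=> A0 [_ _ ->]; have m0 : 0 <= m%:R :> R := ler0n _ m.
have m1 : m.+1%:R = m%:R + 1 :> R by rewrite -natr1.
by rewrite divr_gt0 ?mulr_gt0// euler_Gamma_gt0// ?m1; lra.
Qed.

Lemma jacobi_eval1_rec A B P m : 0 < A -> is_jacobi_family A B P ->
  (m%:R + 2) * (P m.+2).[1] = (m%:R + 2 + A) * (P m.+1).[1].
Proof.
move=> A0 [_ _ p1]; have m0 : 0 <= m%:R :> R := ler0n _ m.
have m1 : m.+1%:R = m%:R + 1 :> R by rewrite -natr1.
have m2 : m.+2%:R = m%:R + 2 :> R by rewrite -[m.+2]addn2 natrD.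
rewrite !p1 m1 m2.
have -> : m%:R + 2 + A + 1 = (m%:R + 1 + A + 1) + 1 :> R by ring.
have -> : m%:R + 2 + 1 = (m%:R + 1 + 1) + 1 :> R by ring.
have g1 : 1 < m%:R + 1 + A + 1 :> R by lra.
have g2 : 1 < m%:R + 1 + 1 :> R by lra.
have g3 : 1 < A + 1 by lra.
rewrite (euler_GammaS g1) (euler_GammaS g2).
have := euler_Gamma_gt0 g1; have := euler_Gamma_gt0 g2.
have := euler_Gamma_gt0 g3.
move: (euler_Gamma _) (euler_Gamma _) (euler_Gamma _) => x y z x0 y0 z0.
by field; rewrite !gt_eqF//=; lra.
Qed.

Lemma jacobi_family_ortho A B P : is_jacobi_family A B P ->
  forall n m, n != m -> jint A B (P n * P m) = 0.
Proof.
move=> [_ oP _] n m nm; rewrite jintE -[RHS](oP n m nm).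
by apply: eq_Rintegral => t _; rewrite hornerM.
Qed.

Lemma jacobi_norm_decay A B P : 0 < A -> 0 < B -> is_jacobi_family A B P ->
  exists2 C, 0 <= C & forall n, jint A B (P n ^+ 2) <= C / n.+1%:R.
Proof.
move=> A0 B0 jP; have [sizeP _ _] := jP; have oP := jacobi_family_ortho jP.
apply: (@norm_ratio_decay _ A B (fun n => jint A B (P n ^+ 2))) => //.
  by move=> n; apply: jint_ge0 => t _; rewrite horner_exp sqr_ge0.
move=> m N; apply: norm_ratio => //.
  by rewrite gt_eqF// (jacobi_eval1_gt0 _ A0 jP).
exact: jacobi_eval1_rec jP.
Qed.

Lemma weight_le_exponent a b a' b' t : 0 < a' -> 0 < b' -> a' <= a -> b' <= b ->
  -1 <= t <= 1 ->
  weight a b t <= (2 `^ (a - a') * 2 `^ (b - b')) * weight a' b' t.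
Proof.
move=> a0 b0 aa bb /andP[t0 t1].
have h x c c' : 0 < c' -> c' <= c -> 0 <= x -> x <= 2 ->
    x `^ c <= 2 `^ (c - c') * x `^ c' :> R.
  move=> c0 cc x0 x2.
  have {1}-> : c = (c - c') + c' by rewrite subrK.
  rewrite powRD; last by apply/implyP => /eqP; lra.
  by rewrite ler_wpM2r ?powR_ge0// ge0_ler_powR ?nnegrE// subr_ge0.
rewrite /weight !pos_powRE; try lra.
by rewrite mulrACA ler_pM ?powR_ge0// h//; lra.
Qed.

(** For [a, b < 1] the weight with exponents [2 a], [2 b] decays more slowly at
    the ends than the orthogonality weight with exponents [a + 1], [b + 1]; the
    gap [1 - a], [1 - b] is below one half and is bridged by the virial
    identity. *)
Lemma jacobi_family_decay a b P : 2^-1 < a -> 2^-1 < b ->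
  is_jacobi_family (a + 1) (b + 1) P ->
  exists2 C, 0 <= C & forall n, jint (2 * a) (2 * b) (P n ^+ 2) <= C / n.+1%:R.
Proof.
move=> a2 b2 jP.
pose s := Num.max 0 (Num.max (1 - a) (1 - b)).
have s0 : 0 <= s by rewrite le_max lexx.
have s2 : s < 2^-1 by rewrite !gt_max; apply/and3P; split; lra.
have sa : 1 - a <= s by rewrite !le_max lexx !orbT.
have sb : 1 - b <= s by rewrite !le_max lexx !orbT.
have A0 : 0 < a + 1 by lra.
have B0 : 0 < b + 1 by lra.
have [C1 C10 HC1] := jacobi_norm_decay A0 B0 jP.
have [l0 [C2 [l00 C20 HC2]]] := @virial_bound R (a + 1) (b + 1) s s0 s2
  (ltac:(clear -a2 s2; lra)) (ltac:(clear -b2 s2; lra)).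
pose X n := jint (a + 1 - s) (b + 1 - s) (P n ^+ 2).
have as0 : 0 < a + 1 - s by lra.
have bs0 : 0 < b + 1 - s by lra.
have X0 n : 0 <= X n by apply: jint_ge0 => t _; rewrite horner_exp sqr_ge0.
pose C3 := 2 `^ (2 * a - (a + 1 - s)) * 2 `^ (2 * b - (b + 1 - s)) : R.
have C30 : 0 <= C3 by rewrite mulr_ge0 ?powR_ge0.
have le1 n : jint (2 * a) (2 * b) (P n ^+ 2) <= C3 * X n.
  rewrite -jintZ//; apply: le_jint; try lra; move=> // t t1.
  rewrite hornerZ mulrAC mulrC ler_wpM2r//; first by rewrite horner_exp sqr_ge0.
  by apply: weight_le_exponent => //; lra.
(* finitely many eigenvalues lie below the threshold [l0] *)
pose n0 := Num.bound l0.
pose C4 := \sum_(k < n0) X k * k.+1%:R.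
have C40 : 0 <= C4 by apply: sumr_ge0 => k _; rewrite mulr_ge0.
exists (C3 * (C2 * C1 + C4)) => [|n]; first by rewrite mulr_ge0 ?addr_ge0 ?mulr_ge0.
apply: le_trans (le1 n) _; rewrite -[leRHS]mulrA ler_wpM2l//.
have [nn0|nn0] := ltnP n n0.
  rewrite ler_pdivlMr ?ltr0n//; apply: ler_wpDl; first by rewrite mulr_ge0.
  rewrite /C4 (bigD1 (Ordinal nn0))//= lerDl.
  by apply: sumr_ge0 => k _; rewrite mulr_ge0.
have [sizeP _ _] := jP.
have ode := jacobi_ode A0 B0 sizeP (jacobi_family_ortho jP) n.
have ln : l0 <= jacobi_eig (a + 1) (b + 1) n.
  have nr : l0 < n%:R.
    have /archi_boundP := ltW l00; move/lt_le_trans; apply.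
    by rewrite ler_nat.
  rewrite /jacobi_eig; move: (n%:R) nr => y yl.
  apply: (le_trans (ltW yl)); rewrite ler_peMr//; first lra.
  by clear -l00 yl a2 b2; lra.
apply: le_trans (HC2 _ _ ln ode) _.
apply: le_trans (ler_wpM2l C20 (HC1 n)) _.
by rewrite mulrA ler_wpM2r ?invr_ge0// lerDl.
Qed.

End FamilyDecay.


(** * Singular values and the Frobenius norm *)

Section SingularValues.
Context {R : realType}.
Local Open Scope sesquilinear_scope.
Local Notation C := R[i].

Section Gram.
Variables (n : nat) (Z : 'M[C]_n).
Local Notation G := (Z^t* *m Z).
Local Notation U := (spectralmx G).

Lemma gram_normal : G \is normalmx.
Proof.
apply/normalmxP; suff -> : G^t* = G by [].
apply/matrixP => i j; rewrite !mxE rmorph_sum; apply: eq_bigr => k _.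
by rewrite !mxE rmorphM /= conjCK mulrC.
Qed.

Lemma gram_spectral : G = U^t* *m diag_mx (spectral_diag G) *m U.
Proof.
have /orthomx_spectralP {1}-> := gram_normal.
by rewrite invmx_unitary// spectral_unitarymx.
Qed.

(** The diagonalised Gram matrix is the Gram matrix of [Z U^*], so its diagonal
    entries are squared column norms. *)
Lemma gram_spectral_diag_ge0 i : 0 <= spectral_diag G 0 i.
Proof.
have /unitarymxP UU := spectral_unitarymx G.
have e : diag_mx (spectral_diag G) = (Z *m U^t*)^t* *m (Z *m U^t*).
  have -> : (Z *m U^t*)^t* = U *m Z^t*.
    apply/matrixP => k l; rewrite !mxE rmorph_sum; apply: eq_bigr => h _.
    by rewrite !mxE rmorphM /= conjCK mulrC.
  rewrite mulmxA -(mulmxA U) [X in U *m X]gram_spectral.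
  by rewrite !mulmxA UU mul1mx -mulmxA UU mulmx1.
have := congr1 (fun M : 'M[C]_n => M i i) e; rewrite !mxE eqxx mulr1n => ->.
by apply: sumr_ge0 => k _; rewrite !mxE mulrC mul_conjC_ge0.
Qed.

Lemma sum_gram_spectral_diag : \sum_i spectral_diag G 0 i = \tr G.
Proof.
have /unitarymxP UU := spectral_unitarymx G.
rewrite [in RHS]gram_spectral mxtrace_mulC mulmxA UU mul1mx.
by rewrite mxtrace_diag.
Qed.

End Gram.

Lemma sum_singular_value_sqr n (M : 'M[R]_n) :
  \sum_i singular_value (map_mx (real_complex R) M) i ^+ 2 =
  \sum_i \sum_j M i j ^+ 2.
Proof.
set Z := map_mx _ M.
have sv i : singular_value Z i ^+ 2 = complex.Re (spectral_diag (Z^t* *m Z) 0 i).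
  rewrite sqr_sqrtr//; have := gram_spectral_diag_ge0 Z i.
  by case: (spectral_diag _ _ _) => x y; rewrite lecE => /andP[].
under eq_bigr do rewrite sv.
rewrite -raddf_sum sum_gram_spectral_diag.
have -> : \tr (Z^t* *m Z) = real_complex R (\sum_i \sum_j M i j ^+ 2).
  rewrite exchange_big rmorph_sum; apply: eq_bigr => i _.
  rewrite !mxE rmorph_sum; apply: eq_bigr => j _.
  rewrite !mxE expr2 rmorphM; congr (_ * _).
  exact: conjc_real.
by [].
Qed.

End SingularValues.


Section ZeroDistributed.
Context {R : realType}.
Local Notation C := R[i].

(** The norm of a complex number is itself an element of [R[i]]; estimates are
    easier on its real part, which carries all of it. *)
Definition modulus (z : C) : R := complex.Re `|z|.

Lemma modulusE z : `|z| = (modulus z)%:C%C.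
Proof.
have := normr_ge0 z; rewrite /modulus; case: `|z| => x y.
by rewrite lecE/= => /andP[/eqP -> _].
Qed.

Lemma modulus_ge0 z : 0 <= modulus z.
Proof. by rewrite -lecR -modulusE; exact: normr_ge0. Qed.

Lemma modulusD x y : modulus (x + y) <= modulus x + modulus y.
Proof. by rewrite -lecR rmorphD/= -!modulusE ler_normD. Qed.

Lemma modulusN x : modulus (- x) = modulus x.
Proof. by rewrite /modulus normrN. Qed.

(** Near 0 continuity gives the constant [e]; away from 0 the bound [B] is
    absorbed by the quadratic term. *)
Lemma quadratic_majorant (h : R -> R) (B e : R) : {for 0, continuous h} ->
  h 0 = 0 -> (forall t, h t <= B) -> 0 < e ->
  exists2 K, 0 <= K & forall t, h t <= e + K * t ^+ 2.
Proof.
move=> ch h0 hB e0.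
have /cvgrPdist_le/(_ _ e0)[d /= d0 hd] := ch.
have B0 : 0 <= B by rewrite -h0.
exists (B / d ^+ 2) => [|t]; first by rewrite divr_ge0// sqr_ge0.
have [td|td] := ltP `|t| d.
  have /hd : ball (0 : R) d t by rewrite /ball/= sub0r normrN.
  rewrite h0 sub0r normrN => /(le_trans (ler_norm _)) het.
  by rewrite ler_wpDr// mulr_ge0 ?sqr_ge0// divr_ge0 ?sqr_ge0.
apply: le_trans (hB t) _; rewrite ler_wpDl ?(ltW e0)//.
rewrite mulrAC ler_pdivlMr ?exprn_gt0// ler_wpM2l//.
by rewrite -[leRHS]real_normK ?num_real// ler_sqr ?nnegrE// ltW.
Qed.

Lemma modulus_compact_support_bounded (F : R -> C^o) : continuous F ->
  compact (closure [set t | F t != 0]) ->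
  continuous (fun t => modulus (F t - F 0)) /\
  exists B, forall t, modulus (F t - F 0) <= B.
Proof.
move=> cF cK; pose h t := modulus (F t - F 0).
have ch : continuous h.
  move=> t; apply/cvgrPdist_lt => e e0.
  have e0' : 0 < e%:C%C :> C by rewrite ltcR.
  have /cvgrPdist_lt/(_ _ e0') := cF t.
  apply: filterS => u; rewrite modulusE ltcR.
  have tri (x y : C) : modulus x - modulus y <= modulus (x - y).
    by rewrite lerBlDr; have := modulusD (x - y) y; rewrite subrK.
  move=> H; apply: le_lt_trans H; rewrite ler_norml /h.
  have e1 (x y z : C) : (x - z) - (y - z) = x - y by ring.
  rewrite -(e1 (F t) (F u) (F 0)) tri andbT lerNl opprB.
  by rewrite -[leRHS]modulusN opprB tri.
split=> //.
have [M [_ HM]] := compact_bounded cK.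
pose m := `|M| + 1.
have m0 : 0 < m by rewrite ltr_wpDl.
have Km t : F t != 0 -> t \in `[- m, m].
  move=> Ft; rewrite in_itv/= -ler_norml; apply: HM.
    by rewrite /m ltr_pwDr// ler_norm.
  exact: subset_closure.
have [c _ hc] := @EVT_max R h (- m) m (ltac:(lra)) (continuous_subspaceT ch).
exists (h c + modulus (F 0)) => t.
have [/eqP Ft|/Km tm] := boolP (F t == 0).
  by rewrite Ft sub0r modulusN lerDr; exact: modulus_ge0.
by rewrite ler_wpDr ?modulus_ge0//; exact: hc.
Qed.

(** The mean of [F] over the singular values differs from [F 0] by at most
    [e + K * t ^ 2] averaged over them, and the squares average to the squared
    Frobenius norm divided by the size. *)
Lemma frobenius_GLT_zero (M : forall N, 'M[R]_N) :
  (N%:R^-1 * \sum_(i < N) \sum_(j < N) M N i j ^+ 2) @[N --> \oo] --> (0 : R) ->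
  GLT_zero (fun N => map_mx (real_complex R) (M N)).
Proof.
move=> M0 F cF cK.
have [ch [B hB]] := modulus_compact_support_bounded cF cK.
pose h t := modulus (F t - F 0).
apply/cvgrPdist_le => eps eps0.
have [e e0 ->] : exists2 e : R, 0 < e & eps = e%:C%C.
  by move: eps0; case: eps => x y; rewrite ltcE/= => /andP[/eqP -> x0]; exists x.
have e20 : 0 < e / 2 by rewrite divr_gt0.
have h0 : h 0 = 0 by rewrite /h subrr /modulus normr0.
have [K K0 HK] := quadratic_majorant (ch 0) h0 hB e20.
have /cvgrPdist_le/(_ (e / 2 / (K + 1))) := M0.
have K1 : 0 < K + 1 by rewrite ltr_wpDl.
move=> /(_ (divr_gt0 e20 K1)) H.
near=> N.
have N0 : (0 < N)%N by near: N; exact: nbhs_infty_gt.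
have HN : `|0 - N%:R^-1 * \sum_(i < N) \sum_(j < N) M N i j ^+ 2| <= e / 2 / (K + 1).
  by near: N.
pose sv := singular_value (map_mx (real_complex R) (M N)).
have NC0 : N%:R != 0 :> C by rewrite pnatr_eq0 -lt0n.
have NR0 : 0 < N%:R :> R by rewrite ltr0n.
have -> : F 0 - N%:R^-1 * \sum_(i < N) F (sv i)
        = N%:R^-1 * \sum_(i < N) (F 0 - F (sv i)) :> C.
  rewrite sumrB mulrBr sumr_const card_ord -[F 0 *+ N]mulr_natl.
  by rewrite mulrA mulVf// mul1r.
rewrite normrM normfV normr_nat.
apply: (@le_trans _ _ (N%:R^-1 * \sum_(i < N) (h (sv i))%:C%C)).
  rewrite ler_wpM2l ?invr_ge0//.
  apply: le_trans (ler_norm_sum _ _ _) _; apply: ler_sum => i _.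
  by rewrite -modulusE -normrN opprB.
have -> : N%:R^-1 * \sum_(i < N) (h (sv i))%:C%C
   = (N%:R^-1 * \sum_(i < N) h (sv i))%:C%C :> C.
  by rewrite rmorphM fmorphV rmorph_nat rmorph_sum.
rewrite lecR.
have S : \sum_(i < N) sv i ^+ 2 = \sum_(i < N) \sum_(j < N) M N i j ^+ 2.
  exact: sum_singular_value_sqr.
apply: (@le_trans _ _ (N%:R^-1 * \sum_(i < N) (e / 2 + K * sv i ^+ 2))).
  by rewrite ler_wpM2l ?invr_ge0//; apply: ler_sum => i _; exact: HK.
rewrite big_split/= sumr_const card_ord -mulr_sumr S mulrDr -[(e / 2) *+ N]mulr_natl.
rewrite mulKf ?gt_eqF// mulrCA.
move: HN; rewrite sub0r normrN ger0_norm; last first.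
  rewrite mulr_ge0 ?invr_ge0//; apply: sumr_ge0 => i _.
  by apply: sumr_ge0 => j _; rewrite sqr_ge0.
set X := _ * _ => HN.
have : K * X <= (K + 1) * (e / 2 / (K + 1)).
  apply: ler_pM => //; last by rewrite lerDl.
  rewrite mulr_ge0 ?invr_ge0//; apply: sumr_ge0 => i _.
  by apply: sumr_ge0 => j _; rewrite sqr_ge0.
rewrite [leRHS]mulrC divfK ?gt_eqF// => h1.
by rewrite [leRHS]splitr lerD2l.
Unshelve. all: by end_near. Qed.

End ZeroDistributed.


(** * Histopolation matrices *)

Section Histopolation.
Context {R : realType}.
Local Notation mu := (@lebesgue_measure R).
Implicit Types (a b t : R) (x : nat -> R) (P : nat -> {poly R}) (N : nat).

Lemma nodes_bounds N x i : is_nodes N x -> (i <= N)%N -> -1 <= x i <= 1.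
Proof.
move=> [x0 xN xS] iN.
have mono j k : (j + k <= N)%N -> x j <= x (j + k)%N.
  elim: k => [|k IH]; first by rewrite addn0.
  rewrite addnS => jk; apply: le_trans (IH (ltnW jk)) _.
  exact/ltW/xS.
have h1 := mono 0%N i iN; have := mono i (N - i)%N; rewrite subnKC// => /(_ (leqnn _)).
by rewrite xN => h2; rewrite -x0 h1 h2.
Qed.

Lemma sum_seg_Rintegral (f : R -> R) N x : continuous f -> is_nodes N x ->
  \sum_(i < N) \int[mu]_(t in `[x i, x i.+1]) f t =
  \int[mu]_(t in `[-1, 1]) f t.
Proof.
move=> cf [x0 xN xS]; rewrite -[in RHS]x0 -[in RHS]xN.
suff H k : (k <= N)%N -> \sum_(i < k) \int[mu]_(t in `[x i, x i.+1]) f t =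
    \int[mu]_(t in `[x 0%N, x k]) f t /\ x 0%N <= x k by have [] := H N (leqnn N).
elim: k => [_|k IH kN].
  by rewrite big_ord0 set_itv1 Rintegral_set1.
have [e le0] := IH (ltnW kN); have xk := ltW (xS _ kN).
rewrite big_ord_recr/= e (seg_Rintegral_cat cf le0 xk); split=> //.
exact: le_trans xk.
Qed.

Lemma weight_sqr a b t : weight a b t ^+ 2 = weight (2 * a) (2 * b) t.
Proof.
have h c u : pos_powR c u ^+ 2 = pos_powR (2 * c) u :> R.
  rewrite /pos_powR [2 * c]mulrC powRrM -powR_mulrn ?powR_ge0//.
by rewrite /weight exprMn !h.
Qed.

(** Cauchy-Schwarz on each segment absorbs the factor [1 / h_i], after which
    the segments add up to the whole interval. *)
Lemma histopolation_frobenius a b P N x : 0 < a -> 0 < b -> is_nodes N x ->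
  \sum_(i < N) \sum_(j < N)
     (sqrt_len_mx N x *m histopolation_mx a b P N x) i j ^+ 2 <=
  \sum_(j < N) jint (2 * a) (2 * b) (P j ^+ 2).
Proof.
move=> a0 b0 nx; rewrite exchange_big; apply: ler_sum => j _.
have c2 : continuous (fun t => (P j ^+ 2).[t] * weight (2 * a) (2 * b) t).
  by apply: jint_continuous; rewrite mulr_gt0.
rewrite /jint -(sum_seg_Rintegral c2 nx); apply: ler_sum => i _.
have h0 : 0 < seg_len x i by rewrite subr_gt0; have [_ _] := nx; apply.
rewrite mul_diag_mx !mxE exprMn sqr_sqrtr ?(ltW h0)// exprMn.
have -> : \int[mu]_(t in `[x i, x i.+1]) ((P j).[t] * jacobi_weight a b t) =
          \int[mu]_(t in `[x i, x i.+1]) ((P j).[t] * weight a b t).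
  apply: eq_Rintegral => t; rewrite inE/= in_itv/= => /andP[t0 t1].
  have /andP[l0 _] := nodes_bounds nx (ltnW (ltn_ord i)).
  have /andP[_ l1] := nodes_bounds nx (ltn_ord i).
  by rewrite weightE// (le_trans l0 t0) (le_trans t1 l1).
have xi : x i < x i.+1 by rewrite -subr_gt0.
have := cauchy_schwarz_seg (@jint_continuous _ _ _ a0 b0 (P j)) xi.
rewrite -/(seg_len x i).
have -> : \int[mu]_(t in `[x i, x i.+1]) (((P j).[t] * weight a b t) ^+ 2) =
   \int[mu]_(t in `[x i, x i.+1]) ((P j ^+ 2).[t] * weight (2 * a) (2 * b) t).
  by apply: eq_Rintegral => t _; rewrite exprMn weight_sqr horner_exp.
move: (Rintegral _ _ _) (Rintegral _ _ _) => I J IJ.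
by rewrite mulrA expr2 mulVKf ?gt_eqF// ler_pdivrMl.
Qed.

Lemma harmonic_le_ln N : (0 < N)%N ->
  \sum_(j < N) (j.+1%:R : R)^-1 <= 1 + ln N%:R.
Proof.
elim: N => // -[_ _|N IH _].
  by rewrite big_ord_recr big_ord0 /= add0r invr1 ln1 addr0.
rewrite big_ord_recr/=; apply: le_trans (lerD (IH isT) (lexx _)) _.
rewrite -addrA lerD2l -lerBrDl.
have n1 : 0 < N.+1%:R :> R by rewrite ltr0n.
have n2 : 0 < N.+2%:R :> R by rewrite ltr0n.
rewrite -lerN2 opprB -ln_div ?posrE//.
rewrite -[leRHS]expRK ler_ln ?posrE ?divr_gt0 ?expR_gt0//.
apply: le_trans (expR_ge1Dx _).
have -> : N.+2%:R = N.+1%:R + 1 :> R by rewrite -[in LHS]natr1.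
move: (N.+1%:R) n1 => n n1.
by rewrite le_eqVlt; apply/orP; left; apply/eqP; field; rewrite gt_eqF//; lra.
Qed.

(** The bound is of order [ln N / N ^ (1 - 2 g)]; with [c] half of the positive
    exponent [1 - 2 g], the logarithm is at most [N ^ c / c]. *)
Lemma harmonic_power_cvg0 (C g : R) (u : nat -> R) : 0 <= C -> g < 2^-1 ->
  (forall N, (0 < N)%N -> 0 <= u N <= N%:R^-1 * (N%:R `^ g) ^+ 2 *
     (C * \sum_(j < N) (j.+1%:R)^-1)) ->
  u @ \oo --> (0 : R).
Proof.
move=> C0 g2 ub; pose c := (1 - 2 * g) / 2.
have c0 : 0 < c by rewrite divr_gt0//; lra.
have key N : (0 < N)%N -> u N <= C * (1 + c^-1) / N%:R `^ c.
  move=> N0; have /andP[_ uN] := ub N N0; apply: le_trans uN _.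
  have n0 : 0 < N%:R :> R by rewrite ltr0n.
  have n1 : 1 <= N%:R :> R by rewrite ler1n.
  have p0 : 0 < N%:R `^ c :> R by rewrite powR_gt0.
  have p1 : 1 <= N%:R `^ c :> R.
    by have := ler_powR n1 (ltW c0); rewrite powRr0.
  have lnN : ln N%:R <= c^-1 * N%:R `^ c :> R.
    rewrite -ler_pdivrMl ?invr_gt0// invrK -ln_powR.
    exact/ltW/ln_sublinear.
  have -> : N%:R^-1 * (N%:R `^ g) ^+ 2 = (N%:R `^ c * N%:R `^ c)^-1 :> R.
    rewrite -powRD; last by apply/implyP => _; rewrite gt_eqF.
    rewrite -powR_mulrn ?powR_ge0// -powRrM -powR_inv1 ?(ltW n0)//.
    rewrite -powRD; last by apply/implyP => _; rewrite gt_eqF.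
    by rewrite -powRN; congr (_ `^ _); rewrite /c; field.
  rewrite mulrC ler_pdivrMr ?mulr_gt0// mulrA divfK ?gt_eqF//.
  rewrite -mulrA ler_wpM2l// mulrDl mul1r.
  apply: le_trans (harmonic_le_ln N0) _.
  by rewrite lerD.
apply/cvgrPdist_le => e e0; near=> N.
have N0 : (0 < N)%N by near: N; exact: nbhs_infty_gt.
have /andP[u0 _] := ub N N0.
rewrite sub0r normrN ger0_norm//; apply: le_trans (key N N0) _.
set D := C * _; have D0 : 0 <= D by rewrite mulr_ge0// addr_ge0// invr_ge0 ltW.
have n0 : 0 < N%:R :> R by rewrite ltr0n.
rewrite ler_pdivrMr ?powR_gt0// mulrC -ler_pdivrMr//.
have -> : D / e = (D / e) `^ (c^-1 * c) by rewrite mulVf ?gt_eqF// powRr1// divr_ge0// ltW.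
rewrite powRrM ge0_ler_powR ?nnegrE ?powR_ge0 ?(ltW c0)//.
by near: N; exact: nbhs_infty_ger.
Unshelve. all: by end_near. Qed.

End Histopolation.

Theorem theorem4p11 (R : realType) (a b : R) (P : nat -> {poly R})
    (x : nat -> nat -> R) (g : R) :
  2^-1 < a -> 2^-1 < b ->
  is_jacobi_family (a + 1) (b + 1) P ->
  (forall N : nat, (0 < N)%N -> is_nodes N (x N)) ->
  g < 2^-1 ->
  GLT_zero (fun N : nat =>
    map_mx (real_complex R)
      (N%:R `^ g *: (sqrt_len_mx N (x N) *m histopolation_mx a b P N (x N)))).
Proof.
move=> a2 b2 jP nx g2; apply: frobenius_GLT_zero.
have a0 : 0 < a by lra.
have b0 : 0 < b by lra.
have [C C0 HC] := jacobi_family_decay a2 b2 jP.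
apply: (harmonic_power_cvg0 C0 g2) => N N0; apply/andP; split.
  rewrite mulr_ge0 ?invr_ge0//; apply: sumr_ge0 => i _.
  by apply: sumr_ge0 => j _; rewrite sqr_ge0.
rewrite -mulrA ler_wpM2l ?invr_ge0//.
under eq_bigr do under eq_bigr do rewrite mxE exprMn.
under eq_bigr do rewrite -mulr_sumr.
rewrite -mulr_sumr ler_wpM2l ?sqr_ge0//.
apply: le_trans (histopolation_frobenius P a0 b0 (nx N N0)) _.
by rewrite mulr_sumr; apply: ler_sum => j _; exact: HC.
Qed.
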